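(* Let $n\ge 2$. For any finitely generated subgroup $\Gamma\subset V_n$, either the action of $\Gamma$ on the Cantor set $K_n$ has a finite orbit or $\Gamma$ contains a free subgroup on two generators.
   Context: Let $n\ge2$ and let $\mathcal T_n$ be the infinite rooted $n$-ary tree, whose vertices are the finite words on $\{0,\dots,n-1\}$. $K_n$ denotes the Cantor set of ends of $\mathcal T_n$, i.e. the space of infinite words on $\{0,\dots,n-1\}$. For a vertex $a$, $K_a\subset K_n$ is the clopen set of infinite words beginning with $a$ (an elementary interval). Thompson's group $V_n$ is the group of homeomorphisms $g$ of $K_n$ for which there are finite families of vertices $a_1,\dots,a_k$ and $b_1,\dots,b_k$ such that $K_n$ is the disjoint union of the $K_{a_i}$ and also the disjoint union of the $K_{b_i}$, and $g(a_iu)=b_iu$ for every $i$ and every infinite word $u$. *)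

(* Defs.v *)
From HB Require Import structures.
From mathcomp Require Import all_boot.
From mathcomp Require Import boolp classical_sets functions cardinality topology.

Set Implicit Arguments.
Unset Strict Implicit.
Unset Printing Implicit Defensive.

Local Open Scope classical_set_scope.
Local Open Scope group_scope.

(* Homeo(T) as a (possibly infinite) groupType. *)
Record homeo (T : topologicalType) := Homeo {
  homeo_fun :> T -> T;
  homeo_inv : T -> T;
  homeo_funK : cancel homeo_fun homeo_inv;
  homeo_invK : cancel homeo_inv homeo_fun;
  homeo_fun_continuous : continuous homeo_fun;
  homeo_inv_continuous : continuous homeo_inv
}.

HB.instance Definition _ (T : topologicalType) := gen_eqMixin (homeo T).
HB.instance Definition _ (T : topologicalType) := gen_choiceMixin (homeo T).

Section HomeoGroup.
Variable T : topologicalType.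
Implicit Types g h : homeo T.

Lemma homeoP g h : g =1 h -> g = h.
Proof.
case: g h => [f f' fK f'K cf cf'] [k k' kK k'K ck ck'] /= /funext fk.
subst k; have f'k' : f' = k' by apply/funext => x; rewrite -[x in LHS]k'K fK.
by subst k'; congr Homeo; exact: Prop_irrelevance.
Qed.

Lemma id_homeo_continuous : continuous (@id T).
Proof. by move=> x; exact: cvg_id. Qed.

Definition homeo1 : homeo T :=
  @Homeo T id id (fun=> erefl) (fun=> erefl)
    id_homeo_continuous id_homeo_continuous.

Definition homeoV g : homeo T :=
  Homeo (@homeo_invK _ g) (@homeo_funK _ g)
    (@homeo_inv_continuous _ g) (@homeo_fun_continuous _ g).

Lemma comp_homeo_continuous (f k : T -> T) :
  continuous f -> continuous k -> continuous (f \o k).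
Proof. by move=> cf ck x; apply: continuous_comp; [exact: ck|exact: cf]. Qed.

Definition homeoM g h : homeo T :=
  @Homeo T (g \o h) (homeo_inv h \o homeo_inv g)
    (can_comp (@homeo_funK _ g) (@homeo_funK _ h))
    (can_comp (@homeo_invK _ h) (@homeo_invK _ g))
    (comp_homeo_continuous (@homeo_fun_continuous _ g)
      (@homeo_fun_continuous _ h))
    (comp_homeo_continuous (@homeo_inv_continuous _ h)
      (@homeo_inv_continuous _ g)).

Lemma homeoMA : associative homeoM.
Proof. by move=> f g h; exact: homeoP. Qed.

Lemma homeo1M : left_id homeo1 homeoM.
Proof. by move=> g; exact: homeoP. Qed.

Lemma homeoM1 : right_id homeo1 homeoM.
Proof. by move=> g; exact: homeoP. Qed.

Lemma homeoVM : left_inverse homeo1 homeoV homeoM.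
Proof. by move=> g; apply: homeoP => x /=; exact: homeo_funK. Qed.

Lemma homeoMV : right_inverse homeo1 homeoV homeoM.
Proof. by move=> g; apply: homeoP => x /=; exact: homeo_invK. Qed.

HB.instance Definition _ :=
  isGroup.Build (homeo T) homeoMA homeo1M homeoM1 homeoVM homeoMV.

End HomeoGroup.

Section AbstractGroups.
Variable G : groupType.

Definition subgroup (H : set G) : Prop :=
  [/\ H 1, forall x y, H x -> H y -> H (x * y) & forall x, H x -> H x^-1].

Definition generated (A : set G) : set G := smallest subgroup A.

Definition finitely_generated (H : set G) : Prop :=
  exists2 A : set G, finite_set A & H = generated A.

(* A letter (i, e) stands for the generator number i if e is false and for
   its inverse if e is true. *)
Definition letter : Type := (bool * bool)%type.

Definition reduced (w : seq letter) : bool :=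
  sorted (fun l m : letter => m != (l.1, ~~ l.2)) w.

Definition eval_letter (a b : G) (l : letter) : G :=
  let x := if l.1 then b else a in if l.2 then x^-1 else x.

Definition eval_word (a b : G) (w : seq letter) : G :=
  \prod_(l <- w) eval_letter a b l.

Definition free_on (a b : G) (H : set G) : Prop :=
  H = generated [set a; b] /\
  forall w, reduced w -> w != [::] -> eval_word a b w <> 1.

Definition contains_free_subgroup2 (H : set G) : Prop :=
  exists F : set G, F `<=` H /\ exists a b : G, free_on a b F.

End AbstractGroups.

Section Thompson.
Variable n : nat.

Definition vertex : Type := seq 'I_n.

Definition K : topologicalType :=
  prod_topology (fun _ : nat => discrete_topology 'I_n).

(* The infinite word a u; the default value of nth is used exactly at the
   positions i >= size a. *)
Definition prepend (a : vertex) (u : K) : K :=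
  fun i : nat => nth (u (i - size a)%N) a i.

Definition elementary_interval (a : vertex) : set K := range (prepend a).

Definition disjoint_cover (k : nat) (a : 'I_k -> vertex) : Prop :=
  trivIset setT (fun i => elementary_interval (a i)) /\
  \bigcup_i elementary_interval (a i) = setT.

Definition thompsonV : set (homeo K) :=
  [set g | exists (k : nat) (a b : 'I_k -> vertex),
    [/\ disjoint_cover a, disjoint_cover b &
        forall i u, g (prepend (a i) u) = prepend (b i) u]].

Definition orbit_of (H : set (homeo K)) (x : K) : set K :=
  [set g x | g in H].

End Thompson.

(* Main.v *)
Require Import Defs.
From mathcomp Require Import all_boot all_order all_algebra.
From mathcomp Require Import boolp classical_sets functions cardinality topology.
From mathcomp Require Import fsbigop zify ring lra.

(** Assume that Gamma has no finite orbit; a free subgroup is found by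
    ping-pong, from an element that is produced by a random walk. Elements of
    V_n are changes of prefix (affine maps) on all sufficiently small
    intervals.

    Every point x has an image h x in an interval K_a that some g in Gamma
    sends into itself by replacing a by a longer prefix a w
    (contraction_exists). Otherwise, along a path in the orbit of x, a pigeonhole
    on prefixes of bounded length bounds the logarithm of the derivative
    of all elements at x, so that all of them are affine on one fixed
    interval around x, with images of bounded depth; the orbit would be finite
    (no_contraction_finite_orbit).

    Consequently there are no almost invariant measures: such a measure would be
    concentrated near the fixed points of finitely many contractions, and
    these points have infinitely many images (no_quasi_invariant). Applied to
    the square of an l2 function, this shows that the Markov operator of a
    random walk with steps in a suitable finite subset S of Gamma has norm less
    than 1 on the l2 space of the discrete set K_n (spectral_gap). So the
    probability that the walk is at y at time k when it starts from x decays
    exponentially in k, uniformly in x and y. The union bound then gives words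
    that avoid any not too large family of transitions from a point to a point
    (escape).

    A long word g can be chosen to match no two vertices of depth at most d,
    where d is a small multiple of its length. Then g sends the complement of T
    into T, where T is the union of the intervals of depth d on which g or its
    inverse is not affine (complement_into). The number of these intervals is at
    most linear in d (word_few_nonaffine), so few that short words, with
    respect to d, move T to pairwise disjoint translates
    (disjoint_translate). If g_0 T, ..., g_4 T are disjoint, then
    g_0 g g_1^-1 and g_2 g g_3^-1 satisfy the hypotheses of ping_pong, with the
    first four sets and a point of the last one. *)

Set Implicit Arguments.
Unset Strict Implicit.
Unset Printing Implicit Defensive.

Local Open Scope classical_set_scope.

(** * Prefixes and affine restrictions *)

Section Vertices.
Variable n : nat.
Implicit Types (a b c : vertex n) (x y u : K n) (g h : homeo (K n)).

(** The prefix of length k of x. *)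
Definition pfx (k : nat) x : vertex n := mkseq x k.

(** The infinite word left when the first k letters of x are removed. *)
Definition shift (k : nat) x : K n := fun i => x (k + i)%N.

(** The point x belongs to the interval of a. *)
Definition starts a x : bool := pfx (size a) x == a.

(** The map g replaces the prefix a by the prefix b on the interval of a; two
    vertices a and b with this property are called matched by g. *)
Definition affine g a b : Prop := forall u, g (prepend a u) = prepend b u.

Lemma homeo_mulE g h x : (g * h)%g x = g (h x). Proof. by []. Qed.
Lemma homeo_1E x : (1%g : homeo (K n)) x = x. Proof. by []. Qed.
Lemma homeo_VK g x : (g^-1)%g (g x) = x. Proof. exact: homeo_funK. Qed.
Lemma homeo_KV g x : g ((g^-1)%g x) = x. Proof. exact: homeo_invK. Qed.
Lemma homeo_inj g : injective g. Proof. exact: can_inj (homeo_VK g). Qed.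

Lemma size_pfx k x : size (pfx k x) = k. Proof. exact: size_mkseq. Qed.

Lemma pfx_prepend a u k : (k <= size a)%N -> pfx k (prepend a u) = take k a.
Proof.
move=> ka; apply: (@eq_from_nth _ (u 0)); first by rewrite size_pfx size_takel.
move=> i; rewrite size_pfx => ik; rewrite nth_mkseq // nth_take //.
by apply: set_nth_default; apply: leq_trans ka.
Qed.

Lemma starts_prepend a u : starts a (prepend a u).
Proof. by rewrite /starts pfx_prepend // take_size. Qed.

Lemma prepend_pfx k x : prepend (pfx k x) (shift k x) = x.
Proof.
apply: funext => i; rewrite /prepend size_pfx.
case: (ltnP i k) => ik; first by rewrite nth_mkseq.
by rewrite nth_default ?size_pfx // /shift subnKC.
Qed.

Lemma startsE a x : starts a x -> x = prepend a (shift (size a) x).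
Proof. by move=> /eqP ax; rewrite -{1}(prepend_pfx (size a) x) ax. Qed.

Lemma starts_pfx k x : starts (pfx k x) x.
Proof. by rewrite /starts size_pfx. Qed.

Lemma prepend_nil u : prepend [::] u = u.
Proof. by apply: funext => i; rewrite /prepend /= nth_nil subn0. Qed.

Lemma prepend_cat a b u : prepend (a ++ b) u = prepend a (prepend b u).
Proof.
apply: funext => i; rewrite /prepend nth_cat size_cat.
case: ltnP => ia; first exact: set_nth_default.
by rewrite [RHS]nth_default // subnDA.
Qed.

Lemma pfx_add k l x : pfx (k + l) x = pfx k x ++ pfx l (shift k x).
Proof.
by rewrite /pfx /mkseq iotaD map_cat add0n -[X in iota X l]addn0 iotaDl -map_comp.
Qed.

Lemma starts_ext a b x : starts a x -> starts b x -> (size a <= size b)%N ->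
  exists c, b = a ++ c.
Proof.
move=> /eqP ax /eqP bx ab; exists (pfx (size b - size a) (shift (size a) x)).
by rewrite -{1}bx -{1}(subnKC ab) pfx_add ax.
Qed.

Lemma prepend_inj a : injective (prepend a).
Proof.
move=> u v uv; apply: funext => i.
move: (congr1 (fun x : K n => x (size a + i)%N) uv).
by rewrite /prepend !nth_default ?leq_addr // addKn.
Qed.

Lemma affine_starts g a b x : affine g a b -> starts a x -> starts b (g x).
Proof. by move=> gab /startsE ->; rewrite gab starts_prepend. Qed.

Lemma affine_cat g a b c : affine g a b -> affine g (a ++ c) (b ++ c).
Proof. by move=> gab u; rewrite !prepend_cat gab. Qed.

Lemma affine_comp g h a b c : affine h a b -> affine g b c -> affine (g * h)%g a c.
Proof. by move=> hab gbc u; rewrite homeo_mulE hab gbc. Qed.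

Lemma affine_inv g a b : affine g a b -> affine (g^-1)%g b a.
Proof. by move=> gab u; rewrite -gab homeo_VK. Qed.

Lemma affine1 a : affine 1%g a a. Proof. by []. Qed.

Hypothesis hn : (2 <= n)%N.

Definition digit0 : 'I_n := Ordinal (ltnW hn).
Definition digit1 : 'I_n := Ordinal hn.
Definition zeros : K n := fun=> digit0.

Lemma prepend_id_nil c : (forall u, prepend c u = u) -> c = [::].
Proof.
case: c => // d c H; pose u : K n := fun=> if d == digit0 then digit1 else digit0.
have := congr1 (fun x : K n => x 0) (H u).
rewrite /prepend /u /=; by case: eqP => [->|nd /nd].
Qed.

Lemma affine_uniq g a b b' : affine g a b -> affine g a b' -> b = b'.
Proof.
wlog: b b' / (size b <= size b')%N.
  move=> W h h'; case: (leqP (size b) (size b')) => [|/ltnW] bb; first exact: W.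
  by apply/esym; apply: W.
move=> bb h h'.
have [c cE] : exists c, b' = b ++ c.
  apply: (@starts_ext _ _ (g (prepend a zeros))) => //.
    by rewrite h starts_prepend.
  by rewrite h' starts_prepend.
rewrite cE (@prepend_id_nil c) ?cats0 // => u; apply: (@prepend_inj b).
by rewrite -prepend_cat -cE -h' h.
Qed.

Lemma affine_src_uniq g a a' b : affine g a b -> affine g a' b -> a = a'.
Proof. by move=> /affine_inv h /affine_inv; exact: affine_uniq. Qed.

(** The change of depth of g near x does not depend on the interval around x
    on which it is read off. *)
Lemma affine_depth g x a b a' b' : affine g a b -> affine g a' b' ->
  starts a x -> starts a' x -> (size b + size a' = size b' + size a)%N.
Proof.
wlog: a b a' b' / (size a <= size a')%N.
  move=> W h h' s s'; case: (leqP (size a) (size a')) => [|/ltnW] aa.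
    exact: W.
  by rewrite (W a' b' a b).
move=> aa h h' s s'; have [c cE] := starts_ext s s' aa.
by subst a'; rewrite (affine_uniq h' (affine_cat c h)) !size_cat; lia.
Qed.

End Vertices.

Section ThompsonFacts.
Variable n : nat.
Implicit Types (a b c : vertex n) (x y u : K n) (g h : homeo (K n)).

(** On every interval of depth at least D, g is a change of prefix. *)
Definition affine_below (D : nat) g :=
  forall a, (D <= size a)%N -> exists b, affine g a b.

Lemma affine_belowW D D' g : (D <= D')%N -> affine_below D g -> affine_below D' g.
Proof. by move=> DD h a aD; apply: h; apply: leq_trans aD. Qed.

Lemma thompson_affine_below (hn : (2 <= n)%N) g :
  thompsonV g -> exists D, affine_below D g.
Proof.
move=> [k [a [b [[_ Ua] _ gE]]]]; exists (\max_(i < k) size (a i)) => c cD.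
have : (\bigcup_i elementary_interval (a i)) (prepend c (zeros hn)) by rewrite Ua.
move=> [i _ [u _ uE]].
have [d cE] : exists d, c = a i ++ d.
  apply: (@starts_ext _ _ _ (prepend c (zeros hn))).
  - by rewrite -uE starts_prepend.
  - exact: starts_prepend.
  - by apply: leq_trans cD; exact: leq_bigmax.
by exists (b i ++ d); rewrite cE; apply: affine_cat; exact: gE.
Qed.

End ThompsonFacts.

(** * Words in a finite set of homeomorphisms *)

Section Words.
Variable n : nat.
Implicit Types (S : seq (homeo (K n))) (g : homeo (K n)).

(** All vertices of depth k. *)
Definition verts (k : nat) : seq (vertex n) := [seq val t | t : k.-tuple 'I_n].

Lemma mem_verts k (a : vertex n) : (a \in verts k) = (size a == k).
Proof.
apply/mapP/eqP => [[t _ ->]|<-]; first exact: size_tuple.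
by exists (in_tuple a) => //; exact: mem_enum.
Qed.

Lemma size_verts k : size (verts k) = (n ^ k)%N.
Proof. by rewrite /verts size_map -cardE card_tuple card_ord. Qed.

(** All vertices of depth at most d. *)
Definition verts_upto (d : nat) : seq (vertex n) :=
  flatten [seq verts k | k <- iota 0 d.+1].

Lemma mem_verts_upto d (a : vertex n) : (a \in verts_upto d) = (size a <= d)%N.
Proof.
apply/flatten_mapP/idP => [[k]|ad].
  by rewrite mem_iota mem_verts add0n ltnS => kd /eqP ->.
by exists (size a); rewrite ?mem_verts // mem_iota.
Qed.

(** g is a product of k elements of S; the last factor acts first. *)
Definition word S (k : nat) g : Prop :=
  exists w, [/\ size w = k, {subset w <= S} & g = (\prod_(s <- w) s)%g].

Lemma word0 S : word S 0 1%g.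
Proof. by exists [::]; split => //; rewrite big_nil. Qed.

Lemma wordS S k s g : s \in S -> word S k g -> word S k.+1 (s * g)%g.
Proof.
move=> sS [w [<- wS ->]]; exists (s :: w); split => //; last by rewrite big_cons.
by move=> t; rewrite inE => /predU1P [->|/wS].
Qed.

Lemma wordM S k l g h : word S k g -> word S l h -> word S (k + l) (g * h)%g.
Proof.
move=> [w [<- wS ->]] [v [<- vS ->]]; exists (w ++ v).
split; [by rewrite size_cat | | by rewrite big_cat].
by move=> t; rewrite mem_cat => /orP [/wS|/vS].
Qed.

Lemma wordSr S k s g : s \in S -> word S k g -> word S k.+1 (g * s)%g.
Proof.
move=> sS wg; rewrite -addn1; apply: wordM => //; exists [:: s].
split => //; last by rewrite big_seq1.
by move=> t; rewrite inE => /eqP ->.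
Qed.

Lemma word_ind S (P : nat -> homeo (K n) -> Prop) :
  P 0 1%g -> (forall k s g, s \in S -> word S k g -> P k g -> P k.+1 (s * g)%g) ->
  forall k g, word S k g -> P k g.
Proof.
move=> P0 PS k g [w [<- wS ->]] {k g}.
elim: w wS => [|s w IH] wS; first by rewrite big_nil.
have wS' : {subset w <= S} by move=> t tw; apply: wS; rewrite inE tw orbT.
by rewrite big_cons; apply: PS; [apply: wS; exact: mem_head|exists w|exact: IH].
Qed.

Lemma word_indr S (P : nat -> homeo (K n) -> Prop) :
  P 0 1%g -> (forall k s g, s \in S -> word S k g -> P k g -> P k.+1 (g * s)%g) ->
  forall k g, word S k g -> P k g.
Proof.
move=> P0 PS k g [w [<- wS ->]] {k g}.
elim/last_ind: w wS => [|w s IH] wS; first by rewrite big_nil.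
have wS' : {subset w <= S} by move=> t tw; apply: wS; rewrite mem_rcons inE tw orbT.
rewrite big_rcons /= size_rcons; apply: PS; [|by exists w|exact: IH].
by apply: wS; rewrite mem_rcons mem_head.
Qed.

Lemma word_sub S (H : set (homeo (K n))) k g : subgroup H ->
  (forall s, s \in S -> H s) -> word S k g -> H g.
Proof. by move=> [H1 HM _] SH; elim/word_ind: g / => // {}k s g /SH sH _; apply: HM. Qed.

Lemma word_inv S k g : (forall s, s \in S -> (s^-1)%g \in S) ->
  word S k g -> word S k (g^-1)%g.
Proof.
move=> SV; elim/word_ind: g /; first by rewrite invg1; exact: word0.
by move=> {}k s g sS _ IH; rewrite invgM; apply: wordSr => //; exact: SV.
Qed.

(** A word of length k is affine below depth D * k and lowers the depth of an
    interval by at most D * k. *)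
Lemma word_affine S D k g a : (forall s, s \in S -> affine_below D s) ->
  word S k g -> (D * k <= size a)%N ->
  exists2 b, affine g a b & (size a <= size b + D * k)%N.
Proof.
move=> SD wg; elim/word_indr: g / wg a => [|{}k s g sS _ IH] a.
  by move=> _; exists a; [exact: affine1|lia].
rewrite mulnS => ka.
have sa : (size (take D a) = D) by rewrite size_takel //; lia.
have [b ab] : exists b, affine s (take D a) b by apply: (SD _ sS); rewrite sa.
have := affine_cat (drop D a) ab; rewrite cat_take_drop => ab'.
have [|c bc cb] := IH (b ++ drop D a).
  by rewrite size_cat size_drop; lia.
exists c; first exact: affine_comp ab' bc.
by move: cb; rewrite size_cat size_drop; lia.
Qed.

End Words.

(** * A point without contraction has a finite orbit *)

Section Contraction.
Variables (n : nat) (hn : (2 <= n)%N).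
Implicit Types (a b c e : vertex n) (x y u : K n) (g h : homeo (K n)).

Import Order.TTheory GRing.Theory Num.Theory.
Local Open Scope ring_scope.

(** The change of depth of g near x, which is the logarithm in base n of the
    inverse of the derivative of g at x; it is 0 by convention when g is not
    affine near x. *)
Definition depth_change g x : int :=
  if pselect (exists ab : vertex n * vertex n, affine g ab.1 ab.2 /\ starts ab.1 x)
  is left H then (size (sval (cid H)).2)%:Z - (size (sval (cid H)).1)%:Z else 0.

Lemma depth_changeE g x a b : affine g a b -> starts a x ->
  depth_change g x = (size b)%:Z - (size a)%:Z.
Proof.
move=> gab ax; rewrite /depth_change; case: pselect => [H|[]]; last by exists (a, b).
case: (cid H) => -[a' b'] /= [gab' ax'].
by have := affine_depth hn gab gab' ax ax'; lia.
Qed.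

(** The map g is affine on all sufficiently small intervals, uniformly. *)
Definition locaff g := exists D, affine_below D g.

Lemma locaff_at g x D : affine_below D g ->
  exists b, affine g (pfx D x) b.
Proof. by move=> H; apply: H; rewrite size_pfx. Qed.

(** The change of depth is a cocycle. *)
Lemma depth_changeM g h x : locaff g -> locaff h ->
  depth_change (g * h)%g x = depth_change g (h x) + depth_change h x.
Proof.
move=> [D gD] [D' hD'].
have [b hb] := locaff_at x hD'.
have := affine_cat (pfx D (shift D' x)) hb; rewrite -pfx_add => {}hb.
have [c gc] : exists c, affine g (b ++ pfx D (shift D' x)) c.
  by apply: gD; rewrite size_cat size_pfx; lia.
have sx := starts_pfx (D' + D) x.
rewrite (depth_changeE hb sx) (depth_changeE (affine_comp hb gc) sx).
by rewrite (depth_changeE gc (affine_starts hb sx)); lia.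
Qed.

Lemma depth_change1 x : depth_change 1%g x = 0.
Proof. by rewrite (@depth_changeE _ _ [::] [::]). Qed.

Variables (S : seq (homeo (K n))) (D E : nat).
Hypothesis SV : forall s, s \in S -> (s^-1)%g \in S.
Hypothesis SD : forall s, s \in S -> affine_below D s.
Hypothesis SE : forall s a b, s \in S -> affine s a b -> size a = D ->
  (size b <= D + E)%N.

Let G g := exists k, word S k g.

Let G_S s : s \in S -> G s.
Proof. by move=> sS; exists 1%N; rewrite -[s]mulg1; apply: wordS => //; exact: word0. Qed.

Let G_1 : G 1%g. Proof. by exists 0%N; exact: word0. Qed.

Let G_M g h : G g -> G h -> G (g * h)%g.
Proof. by move=> [k wk] [l wl]; exists (k + l)%N; exact: wordM. Qed.

Let G_V g : G g -> G (g^-1)%g.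
Proof. by move=> [k wk]; exists k; exact: word_inv. Qed.

Let G_locaff g : G g -> locaff g.
Proof.
move=> [k wk]; exists (D * k)%N => a ak.
by have [b ab _] := word_affine SD wk ak; exists b.
Qed.

Variable x : K n.

Hypothesis NC : forall h g a w, G h -> G g -> starts a (h x) ->
  affine g a (a ++ w) -> w = [::].

(** Assume that no element g of the group generated by S replaces a prefix a
    of a point h x of the orbit of x by a proper extension of a. Let
    x_0 = h x, ..., x_k be the points visited by the letters of the word f, and
    let r_i be the depth change of the part of f from x_i on. The witnesses
    are the maximum M of the r_i, and the set X of the prefixes of length D of
    the x_i at which new maxima occur when the path is read from its end
    (positive ones only). The last property
    says that an interval around h x which is deep enough to stay at depth at
    least D along the whole path can be moved affinely to all of these points,
    losing at most M minus r_0 in depth. It prevents a new maximum at a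
    prefix already in X: there would be a contraction. Since one letter
    raises the maximum by at most E, M is at most E times the size of X. *)
Lemma no_contraction_bound k f : word S k f -> forall h, G h ->
  exists (X : {set D.-tuple 'I_n}) (M : int),
  [/\ depth_change f (h x) <= M, M <= E%:Z * #|X|%:Z &
   forall b, starts b (h x) -> D%:Z + M <= (size b)%:Z + depth_change f (h x) ->
     forall c : D.-tuple 'I_n, c \in X -> exists g e d, [/\ G g, affine g b e,
       (size b)%:Z + depth_change f (h x) - M <= (size e)%:Z & e = c ++ d]].
Proof.
have pre_tuple y : size (pfx D y) == D by rewrite size_pfx.
have selfQ b y : starts b y -> (D <= size b)%N ->
    forall c : D.-tuple 'I_n, c = Tuple (pre_tuple y) -> exists d, b = c ++ d.
  move=> by_ Db c ->; apply: (@starts_ext _ _ _ y) => //=; first exact: starts_pfx.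
  by rewrite size_pfx.
elim/word_indr: f / => [|{}k s f sS wf IH] h Gh.
  exists finset.set0, 0; rewrite depth_change1 finset.cards0 mulr0; split => //.
  by move=> b _ _ c; rewrite finset.in_set0.
have sl := G_locaff (G_S sS).
have fl : locaff f by apply: G_locaff; exists k.
have [X [M [r0M ME Q]]] := IH (s * h)%g (G_M (G_S sS) Gh).
rewrite homeo_mulE in r0M Q.
rewrite depth_changeM //; set r0 := depth_change f _ in r0M Q *.
set dl := depth_change s _.
(* An interval of depth at least D around h x is moved affinely by s. *)
have step b : starts b (h x) -> (D <= size b)%N -> exists b1,
    [/\ affine s b b1, starts b1 (s (h x)) & (size b1)%:Z = (size b)%:Z + dl].
  move=> bx Db; have [b1 sb] := SD sS Db; exists b1; split => //.
    exact: affine_starts sb bx.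
  by rewrite /dl (depth_changeE sb bx); lia.
case: (leP (r0 + dl) M) => rM.
  exists X, M; split => // b bx Mb c cX.
  have [|b1 [sb b1x b1E]] := step b bx; first lia.
  have [|g [e [d [Gg ge es eE]]]] := Q b1 b1x _ c cX; first lia.
  exists (g * s)%g, e, d; split => //; [exact: G_M (G_S sS)|exact: affine_comp ge|lia].
pose t := Tuple (pre_tuple (h x)).
have tX : t \notin X.
  apply/negP => tX; have px := starts_pfx D (h x).
  have [|b1 [sb b1x b1E]] := step _ px; first by rewrite size_pfx.
  rewrite size_pfx in b1E.
  have [|g [e [d [Gg ge es eE]]]] := Q b1 b1x _ t tX; first lia.
  have gs : affine (g * s)%g (pfx D (h x)) (pfx D (h x) ++ d).
    by rewrite -[_ ++ d]eE; exact: affine_comp ge.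
  have d0 := NC Gh (G_M Gg (G_S sS)) px gs.
  by move: es; rewrite eE d0 cats0 size_tuple; lia.
exists (finset.setU [set t]%SET X), (r0 + dl); split => //.
  have dlE : dl <= E.
    have px := starts_pfx D (h x).
    have [|b1 [sb b1x]] := step _ px; first by rewrite size_pfx.
    by have := SE sS sb; rewrite size_pfx => /(_ erefl); lia.
  by rewrite cardsU1 tX; nia.
move=> b bx Mb c; rewrite !inE => /orP [/eqP cE|cX].
  have [|d bE] := selfQ b _ bx _ _ cE; first lia.
  by exists 1%g, b, d; split => //; lia.
have [|b1 [sb b1x b1E]] := step b bx; first lia.
have [|g [e [d [Gg ge es eE]]]] := Q b1 b1x _ c cX; first lia.
exists (g * s)%g, e, d; split => //; [exact: G_M (G_S sS)|exact: affine_comp ge|lia].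
Qed.

(** The depth changes at x are then bounded below by minus the constant C, and
    above by C. So every word is affine on the same interval around x, with
    images of bounded depth; this leaves finitely many images of x. *)
Lemma no_contraction_finite_orbit : finite_set [set g x | g in G].
Proof.
pose C := (E * #|{: D.-tuple 'I_n}|)%N.
have upper f h : G f -> G h -> depth_change f (h x) <= C.
  move=> [k wf] Gh; have [X [M [rM ME _]]] := no_contraction_bound wf Gh.
  apply: le_trans rM _; apply: le_trans ME _; rewrite /C PoszM ler_wpM2l //.
  by rewrite lez_nat max_card.
have lower f : G f -> - C%:Z <= depth_change f x.
  move=> Gf; have := upper _ _ (G_V Gf) Gf.
  have := depth_changeM x (G_locaff (G_V Gf)) (G_locaff Gf).
  by rewrite mulVg depth_change1; lia.
have upper1 f : G f -> depth_change f x <= C by move=> Gf; exact: (upper f 1%g Gf G_1).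
pose b := pfx (D + C) x; pose u := shift (D + C) x.
have bx : starts b x := starts_pfx _ x.
have main k f : word S k f -> exists e, affine f b e.
  elim/word_ind: f / => [|{}k s f sS wf [e fe]]; first by exists b; exact: affine1.
  have De : (D <= size e)%N.
    have := lower f; rewrite (depth_changeE fe bx) size_pfx.
    by move=> /(_ (ex_intro _ k wf)); lia.
  have [e' se] := SD sS De; exists e'; exact: affine_comp fe se.
apply: (@sub_finite_set _ _ [set prepend e u | e in [set` verts_upto n (D + C + C)]]).
  move=> y [f [k wf] <-]; have [e fe] := main k f wf.
  exists e; last by rewrite -fe /b /u prepend_pfx.
  rewrite /= mem_verts_upto.
  have := upper1 f (ex_intro _ k wf); rewrite (depth_changeE fe bx) size_pfx; lia.
exact/finite_image/finite_seq.
Qed.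

End Contraction.

(** * Contractions in groups without finite orbits *)

(** Finitely many nonempty upward closed sets of natural numbers meet. *)
Lemma common_bound (T : eqType) (P : T -> nat -> Prop) (l : seq T) :
  (forall s i j, (i <= j)%N -> P s i -> P s j) ->
  (forall s, s \in l -> exists i, P s i) ->
  exists i, forall s, s \in l -> P s i.
Proof.
move=> Pmono; elim: l => [|s l IH] H; first by exists 0.
have [i Hi] := H s (mem_head _ _).
have [|j Hj] := IH; first by move=> t tl; apply: H; rewrite inE tl orbT.
exists (maxn i j) => t; rewrite inE => /predU1P [->|/Hj].
  by apply: Pmono Hi; exact: leq_maxl.
by apply: Pmono; exact: leq_maxr.
Qed.

Lemma uniq_map_inj (T U : eqType) (f : T -> U) (l : seq T) (s t : T) :
  uniq (map f l) -> s \in l -> t \in l -> f s = f t -> s = t.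
Proof.
elim: l => //= r l IH /andP [rl ul]; rewrite !inE.
move=> /predU1P [->|sl] /predU1P [->|tl] // E; last exact: IH.
  by move: rl; rewrite E map_f.
by move: rl; rewrite -E map_f.
Qed.

Lemma bigcup_cons (T : eqType) (U : Type) (F : T -> set U) (s : T) (l : seq T) :
  \bigcup_(t in [set` s :: l]) F t = F s `|` \bigcup_(t in [set` l]) F t.
Proof.
apply/seteqP; split => x.
  by move=> [t]; rewrite /= inE => /predU1P [-> Fx|tl Fx]; [left|right; exists t].
move=> [Fx|[t /= tl Fx]]; first by exists s => //=; exact: mem_head.
by exists t => //=; rewrite inE tl orbT.
Qed.

Section Generators.
Variables (n : nat) (hn : (2 <= n)%N) (Gamma : set (homeo (K n))).
Hypothesis Gsub : subgroup Gamma.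
Hypothesis GV : Gamma `<=` thompsonV (n := n).
Hypothesis Gfg : finitely_generated Gamma.
Implicit Types (a b c e : vertex n) (x y u : K n) (g h : homeo (K n)).

Let GI g : Gamma g -> Gamma (g^-1)%g.
Proof. by case: Gsub => _ _ H; exact: H. Qed.

Lemma subgroup_locaff g : Gamma g -> exists D, affine_below D g.
Proof. by move=> /GV; exact: thompson_affine_below. Qed.

Lemma symmetric_generators : exists S : seq (homeo (K n)),
  [/\ forall s, s \in S -> Gamma s, forall s, s \in S -> (s^-1)%g \in S &
      forall g, Gamma g -> exists k, word S k g].
Proof.
have [A /finite_seqP [l lE] GE] := Gfg.
have lG s : s \in l -> Gamma s.
  by move=> sl; rewrite GE => H [_ AH]; apply: AH; rewrite lE.
pose S0 := l ++ map (fun s => s^-1)%g l; exists S0.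
have SV s : s \in S0 -> (s^-1)%g \in S0.
  rewrite !mem_cat => /orP [sl|/mapP [t tl ->]]; last by rewrite invgK tl.
  by apply/orP; right; apply/mapP; exists s.
split => //.
  by move=> s; rewrite mem_cat => /orP [/lG //|/mapP [t /lG tl ->]]; exact: GI.
move=> g; rewrite GE => H; apply: (H [set g | exists k, word S0 k g]); split => /=.
  split; first by exists 0; exact: word0.
    by move=> f h [k wf] [m wh]; exists (k + m); exact: wordM.
  by move=> f [k wf]; exists k; exact: word_inv.
move=> s; rewrite lE /= => sl; exists 1; rewrite -[s]mulg1.
by apply: wordS (word0 _); rewrite mem_cat sl.
Qed.

Hypothesis orbits_infinite : forall x, ~ finite_set (orbit_of Gamma x).

Lemma contraction_exists x : exists h g a w,
  [/\ Gamma h, Gamma g, starts a (h x), affine g a (a ++ w) & w <> [::]].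
Proof.
have [S [SG SV GS]] := symmetric_generators.
have [D SD] : exists D, forall s, s \in S -> affine_below D s.
  apply: common_bound => [s i j|s /SG]; first exact: affine_belowW.
  exact: subgroup_locaff.
have [E SE] : exists E, forall s, s \in S -> forall a b, affine s a b ->
    size a = D -> (size b <= D + E)%N.
  apply: (@common_bound _ (fun s E => forall a b, affine s a b ->
    size a = D -> (size b <= D + E)%N)) => [s i j ij H a b ab aD|s sS].
    by have := H a b ab aD; lia.
  have [E HE] : exists E, forall a, a \in verts n D -> forall b, affine s a b ->
      (size b <= D + E)%N.
    apply: (@common_bound _ (fun a E => forall b, affine s a b ->
      (size b <= D + E)%N)) => [a i j ij H b ab|a _].
      by have := H b ab; lia.
    case: (pselect (exists b, affine s a b)) => [[b ab]|H]; last first.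
      by exists 0 => b ab; case: H; exists b.
    by exists (size b) => b' ab'; rewrite (affine_uniq hn ab' ab); lia.
  by exists E => a b ab aD; apply: HE ab; rewrite mem_verts aD.
apply: contrapT => H; apply: (orbits_infinite (x := x)).
have -> : orbit_of Gamma x = [set g x | g in [set g | exists k, word S k g]].
  apply/seteqP; split => y [g Gg <-]; exists g => //; first exact: GS.
  by case: Gg => k; exact: word_sub.
have ex_word g : (exists k, word S k g) -> Gamma g.
  by move=> [k]; exact: word_sub.
apply: (@no_contraction_finite_orbit n hn S D E) => //.
  by move=> s a b sS; exact: SE.
move=> h g a w /ex_word Gh /ex_word Gg ah ga; apply: contrapT => w0.
by apply: H; exists h, g, a, w.
Qed.

Lemma elementary_intervalP a x : elementary_interval a x <-> starts a x.
Proof.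
split; first by case=> u _ <-; exact: starts_prepend.
by move=> /startsE ->; exists (shift (size a) x).
Qed.

(** The first D + e letters of x determine the first e letters of g x. *)
Lemma affine_below_pfx D g (e : nat) x y : affine_below D g ->
  pfx (D + e) x = pfx (D + e) y -> pfx e (g x) = pfx e (g y).
Proof.
move=> gD; rewrite !pfx_add => /eqP; rewrite eqseq_cat ?size_pfx //.
move=> /andP [/eqP exy /eqP etl].
have [b gb] : exists b, affine g (pfx D x) b by apply: gD; rewrite size_pfx.
rewrite -{1}(prepend_pfx D x) -(prepend_pfx D y) -exy !gb.
apply: (@eq_from_nth _ (digit0 hn)); rewrite ?size_pfx // => i ie.
rewrite !nth_mkseq // /prepend; case: (ltnP i (size b)) => ib.
  exact: set_nth_default.
rewrite !nth_default //.
move: (congr1 (fun s => nth (digit0 hn) s (i - size b)) etl).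
by rewrite !nth_mkseq //; lia.
Qed.

Lemma image_elementary_interval g a b : affine g a b ->
  g @` elementary_interval a = elementary_interval b.
Proof.
move=> gab; apply/seteqP; split => y.
  by case=> z [u _ <-] <-; exists u.
by case=> u _ <-; exists (prepend a u); [exists u|].
Qed.

End Generators.

(** * Null sets of almost invariant measures *)

Section Null.
Import Order.TTheory GRing.Theory Num.Theory.
Local Open Scope ring_scope.

Variables (n : nat).
Implicit Types (a b c e : vertex n) (x y u : K n) (g h : homeo (K n)).

(** Finitely additive probabilities, defined on all subsets. *)
Definition finadd_prob (mu : set (K n) -> rat) : Prop :=
  [/\ mu setT = 1, forall A, 0 <= mu A &
      forall A B, A `&` B = set0 -> mu (A `|` B) = mu A + mu B].

(** No element of S lowers the measure of a set by more than eps. *)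
Definition quasi_inv (S : seq (homeo (K n))) (eps : rat) (mu : set (K n) -> rat) :=
  forall s A, s \in S -> mu A <= mu (s @` A) + eps.

Lemma finadd_prob_mono mu A B : finadd_prob mu -> A `<=` B -> mu A <= mu B.
Proof.
move=> [_ mu0 muU] AB; have -> : B = A `|` (B `\` A).
  by rewrite setDE setUIr setUv setIT setUidr.
by rewrite muU ?setDIK // lerDl.
Qed.

Lemma finadd_prob_setU mu A B : finadd_prob mu -> mu (A `|` B) <= mu A + mu B.
Proof.
move=> mup; case: (mup) => _ mu0 muU; have -> : A `|` B = A `|` (B `\` A).
  by rewrite setUDr setDv setD0.
by rewrite muU ?setDIK // lerD2l; apply: finadd_prob_mono => //; exact: subDsetl.
Qed.

Lemma finadd_prob_le1 mu A : finadd_prob mu -> mu A <= 1.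
Proof. by move=> mup; case: (mup) => <- _ _; apply: finadd_prob_mono. Qed.

Lemma finadd_prob_sum (T : eqType) (F : T -> set (K n)) (l : seq T) mu : finadd_prob mu ->
  uniq l -> (forall s t, s \in l -> t \in l -> s <> t -> F s `&` F t = set0) ->
  \sum_(s <- l) mu (F s) <= 1.
Proof.
move=> mup ul lF.
suff : \sum_(s <- l) mu (F s) <= mu (\bigcup_(s in [set` l]) F s).
  by move=> /le_trans; apply; exact: finadd_prob_le1.
elim: l ul lF => [|s l IH] /=; first by rewrite big_nil; case: mup.
move=> /andP [sl ul] lF; rewrite big_cons bigcup_cons.
case: (mup) => _ _ ->.
  rewrite lerD2l IH // => t t' tl tl'.
  by apply: lF; rewrite inE ?tl ?tl' orbT.
rewrite setI_bigcupr bigcup0 // => t /= tl; apply: lF; rewrite ?mem_head //.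
  by rewrite inE tl orbT.
by move=> st; rewrite st tl in sl.
Qed.

Variable Gamma : set (homeo (K n)).

(** A set is null if its measure is arbitrarily small for every probability
    that is sufficiently invariant under a suitable finite subset of Gamma. *)
Definition null (B : set (K n)) : Prop := forall eta : rat, 0 < eta ->
  exists S eps, [/\ forall s, s \in S -> Gamma s, 0 < eps &
    forall mu, finadd_prob mu -> quasi_inv S eps mu -> mu B <= eta].

Lemma null_sub A B : A `<=` B -> null B -> null A.
Proof.
move=> AB nB eta eta0; have [S [eps [SG eps0 H]]] := nB eta eta0.
exists S, eps; split => // mu mup muS; apply: le_trans (H mu mup muS).
exact: finadd_prob_mono.
Qed.

Lemma null_image h A : Gamma h -> null (h @` A) -> null A.
Proof.
move=> Gh nA eta eta0.
have eta2 : 0 < eta / 2 by lra.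
have [S [eps [SG eps0 H]]] := nA _ eta2.
exists (h :: S), (Num.min eps (eta / 2)); split.
- by move=> s; rewrite inE => /predU1P [->|/SG].
- by rewrite lt_min eps0 eta2.
move=> mu mup muS.
have muS' : quasi_inv S eps mu.
  move=> s B sS; apply: le_trans (muS s B _) _; first by rewrite inE sS orbT.
  by rewrite lerD2l ge_min lexx.
have := H mu mup muS'; have := muS h A (mem_head _ _).
have : Num.min eps (eta / 2) <= eta / 2 by rewrite ge_min lexx orbT.
lra.
Qed.

Lemma nullU A B : null A -> null B -> null (A `|` B).
Proof.
move=> nA nB eta eta0.
have eta2 : 0 < eta / 2 by lra.
have [S [eps [SG eps0 H]]] := nA _ eta2.
have [S' [eps' [SG' eps0' H']]] := nB _ eta2.
exists (S ++ S'), (Num.min eps eps'); split.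
- by move=> s; rewrite mem_cat => /orP [/SG|/SG'].
- by rewrite lt_min eps0 eps0'.
move=> mu mup muS.
have muS1 : quasi_inv S eps mu.
  move=> s C sS; apply: le_trans (muS s C _) _; first by rewrite mem_cat sS.
  by rewrite lerD2l ge_min lexx.
have muS2 : quasi_inv S' eps' mu.
  move=> s C sS; apply: le_trans (muS s C _) _; first by rewrite mem_cat sS orbT.
  by rewrite lerD2l ge_min lexx orbT.
by have := H mu mup muS1; have := H' mu mup muS2; have := finadd_prob_setU A B mup; lra.
Qed.

Lemma null0 : null set0.
Proof.
move=> eta eta0; exists [::], 1; split => // mu mup _.
case: mup => _ _ /(_ set0 set0); rewrite setI0 setU0 => /(_ erefl); lra.
Qed.

End Null.

(** * Almost invariant measures do not exist without finite orbits *)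

Section NullK.
Import Order.TTheory GRing.Theory Num.Theory.
Local Open Scope ring_scope.
Variables (n : nat) (hn : (2 <= n)%N) (Gamma : set (homeo (K n))).
Hypothesis Gsub : subgroup Gamma.
Hypothesis GV : Gamma `<=` thompsonV (n := n).
Hypothesis Gfg : finitely_generated Gamma.
Hypothesis orbits_infinite : forall x, ~ finite_set (orbit_of Gamma x).
Implicit Types (a b c e : vertex n) (x y u : K n) (g h : homeo (K n)).

Lemma many_images x (m : nat) : exists l : seq (homeo (K n)),
  [/\ size l = m, forall g, g \in l -> Gamma g & uniq (map (fun g => g x) l)].
Proof.
elim: m => [|m [l [lm lG lu]]]; first by exists [::].
have [g Gg gx] : exists2 g, Gamma g & g x \notin map (fun g => g x) l.
  apply: contrapT => H; apply: (orbits_infinite (x := x)).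
  apply: (@sub_finite_set _ _ [set` map (fun g => g x) l]); last exact: finite_seq.
  move=> y [g Gg <-] /=; case: (boolP (g x \in _)) => // gx.
  by case: H; exists g.
exists (g :: l); split; rewrite /= ?lm ?gx //.
by move=> h; rewrite inE => /predU1P [->|/lG].
Qed.

(** The concatenation of j copies of w. *)
Definition wpow (w : vertex n) (j : nat) : vertex n := iter j (cat w) [::].

(** The infinite repetition of w, for nonempty w. *)
Definition periodic (w : vertex n) : K n := fun i => nth (digit0 hn) w (i %% size w).

Lemma prepend_periodic w : prepend w (periodic w) = periodic w.
Proof.
apply: funext => i; rewrite /prepend /periodic.
case: (ltnP i (size w)) => iw.
  by rewrite (modn_small iw); exact: set_nth_default.
by rewrite nth_default // -{2}(subnK iw) modnDr.
Qed.

Lemma starts_wpow a w j : starts (a ++ wpow w j) (prepend a (periodic w)).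
Proof.
have -> : prepend a (periodic w) = prepend (a ++ wpow w j) (periodic w).
  rewrite prepend_cat; congr prepend.
  by elim: j => [|j IH] /=; rewrite ?prepend_nil ?prepend_cat -?IH ?prepend_periodic.
exact: starts_prepend.
Qed.

Lemma size_wpow w j : w <> [::] -> (j <= size (wpow w j))%N.
Proof. by case: w => // i w _; elim: j => //= j IH; rewrite size_cat; lia. Qed.

(** A contraction g shrinks the interval of a to the fixed point p of g without
    much loss of measure; since p has infinitely many images under the group,
    a small neighbourhood of p has many disjoint translates. *)
Lemma null_contraction g a w : Gamma g -> affine g a (a ++ w) -> w <> [::] ->
  null Gamma (elementary_interval a).
Proof.
move=> Gg ga w0 eta eta0.
pose M := Num.bound (2 / eta); pose p := prepend a (periodic w).
have M2 : 2 / eta < M%:R by apply: archi_boundP; apply: divr_ge0 => //; exact: ltW.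
have M0 : 0 < M%:R :> rat by apply: le_lt_trans M2; apply: divr_ge0 => //; exact: ltW.
have [l [lM lG lu]] := many_images p M.
have [D lD] : exists D, forall s, s \in l -> affine_below D s.
  apply: common_bound => [s i j|s /lG]; first exact: affine_belowW.
  exact: (subgroup_locaff hn GV).
have [d ld] : exists d, forall s, s \in [seq (s, t) | s <- l, t <- l] ->
    s.1 p <> s.2 p -> pfx d (s.1 p) <> pfx d (s.2 p).
  apply: (@common_bound (homeo (K n) * homeo (K n))%type
    (fun s d => s.1 p <> s.2 p -> pfx d (s.1 p) <> pfx d (s.2 p))).
    move=> s i j ij H st /(congr1 (take i)) E; apply: (H st).
    by move: E; rewrite -!map_take !take_iota (minn_idPl ij).
  move=> [s t] _ /=; case: (pselect (s p = t p)) => st; first by exists 0%N.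
  have [i sti] : exists i, s p i <> t p i.
    by apply: contrapT => H; apply/st/funext => i;
      apply: contrapT => ?; apply: H; exists i.
  exists i.+1 => _ /(congr1 (fun v => nth (digit0 hn) v i)).
  by rewrite !nth_mkseq.
pose j := (D + d)%N; pose Q := elementary_interval (a ++ wpow w j).
have Qp x : Q x -> pfx (D + d) x = pfx (D + d) p.
  move=> /elementary_intervalP sx; have sp := starts_wpow a w j; rewrite -/p in sp.
  have szj : (D + d <= size (a ++ wpow w j))%N.
    by rewrite size_cat; have := size_wpow j w0; rewrite /j; lia.
  by rewrite (startsE sx) (startsE sp) !pfx_prepend.
have disj s t : s \in l -> t \in l -> s <> t -> (s @` Q) `&` (t @` Q) = set0.
  move=> sl tl st; rewrite -subset0 => z [[x Qx <-] [y Qy yx]].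
  have stp : s p <> t p.
    by move=> E; apply: st; exact: (uniq_map_inj lu).
  apply: (ld (s, t) (allpairs_f pair sl tl) stp) => /=.
  rewrite -(affine_below_pfx hn (lD _ sl) (Qp _ Qx)).
  by rewrite -(affine_below_pfx hn (lD _ tl) (Qp _ Qy)) yx.
pose eps : rat := (M%:R * j.+1%:R)^-1.
have eps0 : 0 < eps by rewrite invr_gt0 mulr_gt0 // ltr0n.
have jn0 : j.+1%:R != 0 :> rat by rewrite pnatr_eq0.
have epsE : eps = M%:R^-1 * j.+1%:R^-1 by rewrite /eps invfM.
exists (g :: l), eps; split => //.
  by move=> s; rewrite inE => /predU1P [->|/lG].
move=> mu mup muS.
have shrink i : mu (elementary_interval a) <=
    mu (elementary_interval (a ++ wpow w i)) + i%:R * eps.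
  elim: i => [|i IH]; first by rewrite cats0 mul0r addr0.
  apply: le_trans IH _; rewrite -natr1 mulrDl mul1r addrA addrAC lerD2r.
  have -> : elementary_interval (a ++ wpow w i.+1) =
      g @` elementary_interval (a ++ wpow w i).
    by rewrite (image_elementary_interval (affine_cat (wpow w i) ga)) /= catA.
  by apply: muS; exact: mem_head.
have Qle : M%:R * (mu Q - eps) <= 1.
  have ul : uniq l by apply: map_uniq lu.
  apply: le_trans (finadd_prob_sum mup ul disj).
  have -> : M%:R * (mu Q - eps) = \sum_(s <- l) (mu Q - eps).
    by rewrite big_const_seq count_predT lM iter_addr addr0 mulr_natl.
  rewrite big_seq [leRHS]big_seq; apply: ler_sum => s sl.
  by rewrite lerBlDr; apply: muS; rewrite inE sl orbT.
have : mu Q - eps <= M%:R^-1 by rewrite -ler_pdivlMl // mulr1 in Qle.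
have jeps : M%:R^-1 = j.+1%:R * eps by rewrite epsE mulrC mulfVK.
rewrite jeps.
have : 2 * (j.+1%:R * eps) <= eta.
  rewrite -jeps ler_pdivrMr // mulrC -ler_pdivrMr //; exact: ltW.
by have := shrink j; rewrite -/Q -natr1 mulrDl mul1r; lra.
Qed.

(** Every point has a null neighbourhood, hence the whole space is null by
    compactness, in the form of Koenig's lemma on the tree of vertices. *)
Lemma null_setT : null Gamma setT.
Proof.
pose bad a := ~ null Gamma (elementary_interval a).
have child a : bad a -> exists i, bad (rcons a i).
  move=> ba; apply: contrapT => H; apply: ba.
  have nch i : null Gamma (elementary_interval (rcons a i)).
    by apply: contrapT => ?; apply: H; exists i.
  suff : null Gamma (\bigcup_(i in [set` enum 'I_n]) elementary_interval (rcons a i)).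
    apply: null_sub => x /elementary_intervalP ax.
    exists (x (size a)); first by rewrite /= mem_enum.
    apply/elementary_intervalP; rewrite /starts size_rcons -addn1 pfx_add (eqP ax) -cats1.
    rewrite /shift /pfx /mkseq /=; apply/eqP; congr (_ ++ [:: x _]); lia.
  elim: (enum 'I_n) => [|i l IH].
    by rewrite classical_sets.set_nil bigcup_set0; exact: null0.
  by rewrite bigcup_cons; apply: nullU.
apply: contrapT => nT.
have bad0 : bad [::].
  by apply: contra_not nT; apply: null_sub => x _; apply/elementary_intervalP.
have [st stP] : {st : vertex n -> 'I_n | forall a, bad a -> bad (rcons a (st a))}.
  apply: cid; suff : forall a, exists i, bad a -> bad (rcons a i).
    by move=> /choice [st H]; exists st.
  move=> a; case: (pselect (bad a)) => [/child [i Hi]|na]; first by exists i.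
  by exists (digit0 hn).
pose v k := iter k (fun a => rcons a (st a)) [::].
pose x : K n := fun k => st (v k).
have vE k : pfx k x = v k.
  by elim: k => // k IH; rewrite /pfx mkseqS -/(pfx k x) IH.
have vbad k : bad (v k) by elim: k => //= k IH; exact: stP.
have [h [g [a [w [Gh Gg ahx ga w0]]]]] :=
  contraction_exists hn Gsub GV Gfg orbits_infinite x.
have [D hD] := subgroup_locaff hn GV Gh.
apply: (vbad (D + size a)%N); rewrite -vE; apply: (null_image Gh).
apply: null_sub (null_contraction Gg ga w0) => z [y /elementary_intervalP + <-].
rewrite /starts size_pfx => /eqP yx; apply/elementary_intervalP.
by rewrite /starts (affine_below_pfx hn hD yx).
Qed.

Lemma no_quasi_invariant : exists S eps,
  [/\ forall s, s \in S -> Gamma s, 0 < eps &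
    forall mu, finadd_prob mu -> ~ quasi_inv S eps mu].
Proof.
have [|S [eps [SG eps0 H]]] := null_setT (eta := 2^-1); first by lra.
exists S, eps; split => // mu mup /(H mu mup).
by case: mup => -> _ _; lra.
Qed.

End NullK.

(** * Finitely supported sums and the spectral gap *)

Section FiniteSums.
Import Order.TTheory GRing.Theory Num.Theory.
Local Open Scope ring_scope.
Variable T : choiceType.
Implicit Types (f g : T -> rat).

(** The function f has finite support. *)
Definition finsupp f := exists Z : seq T, forall x, f x != 0 -> x \in Z.

(** The sum of all the values of f. *)
Definition fsum f : rat := \sum_(x \in [set: T]) f x.

Lemma fsumE (Z : seq T) f : uniq Z -> (forall x, f x != 0 -> x \in Z) ->
  fsum f = \sum_(x <- Z) f x.
Proof.
move=> uZ fZ; rewrite /fsum (@fsbigE _ _ _ _ _ Z) //.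
  by apply: eq_bigl => x; rewrite in_setT.
by move=> x _ xZ; apply/eqP; apply: contraNT xZ; exact: fZ.
Qed.

Lemma finsupp_uniq f g : finsupp f -> finsupp g -> exists2 Z, uniq Z &
  (forall x, f x != 0 -> x \in Z) /\ (forall x, g x != 0 -> x \in Z).
Proof.
move=> [Z fZ] [Y gY]; exists (undup (Z ++ Y)); first exact: undup_uniq.
by split => x; rewrite mem_undup mem_cat => H; [rewrite fZ|rewrite gY ?orbT].
Qed.

Lemma finsupp_dom2 f g h : finsupp f -> finsupp g ->
  (forall x, f x = 0 -> g x = 0 -> h x = 0) -> finsupp h.
Proof.
move=> /finsupp_uniq H /H {H} [Z _ [fZ gZ]] fgh; exists Z => x hx.
case: (eqVneq (f x) 0) => [f0|/fZ //]; case: (eqVneq (g x) 0) => [g0|/gZ //].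
by rewrite fgh ?eqxx in hx.
Qed.

Lemma finsupp_dom f h : finsupp f -> (forall x, f x = 0 -> h x = 0) -> finsupp h.
Proof. by move=> ff fh; apply: (finsupp_dom2 ff ff) => x /fh. Qed.

Lemma finsupp_bij f (u v : T -> T) : cancel u v -> finsupp f -> finsupp (fun x => f (u x)).
Proof.
move=> uK [Z fZ]; exists (map v Z) => x /fZ ux.
by apply/mapP; exists (u x).
Qed.

Lemma fsumD f g : finsupp f -> finsupp g -> fsum (fun x => f x + g x) = fsum f + fsum g.
Proof.
move=> /finsupp_uniq H /H {H} [Z uZ [fZ gZ]].
rewrite (fsumE uZ fZ) (fsumE uZ gZ) (@fsumE Z) ?big_split // => x.
case: (eqVneq (f x) 0) => [->|/fZ //]; case: (eqVneq (g x) 0) => [->|/gZ //].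
by rewrite addr0 eqxx.
Qed.

Lemma fsumZ c f : finsupp f -> fsum (fun x => c * f x) = c * fsum f.
Proof.
move=> ff; have [Z uZ [fZ _]] := finsupp_uniq ff ff.
rewrite (fsumE uZ fZ) (@fsumE Z) ?mulr_sumr // => x.
by rewrite mulf_eq0 negb_or => /andP [_ /fZ].
Qed.

Lemma fsum_le f g : finsupp f -> finsupp g -> (forall x, f x <= g x) -> fsum f <= fsum g.
Proof.
move=> /finsupp_uniq H /H {H} [Z uZ [fZ gZ]] fg.
by rewrite (fsumE uZ fZ) (fsumE uZ gZ); apply: ler_sum.
Qed.

Lemma fsum_ge0 f : finsupp f -> (forall x, 0 <= f x) -> 0 <= fsum f.
Proof.
move=> ff f0; have [Z uZ [fZ _]] := finsupp_uniq ff ff.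
by rewrite (fsumE uZ fZ); apply: sumr_ge0.
Qed.

Lemma fsum_bij f (u v : T -> T) : cancel u v -> cancel v u ->
  fsum (fun x => f (u x)) = fsum f.
Proof. by move=> uK vK; rewrite /fsum [RHS](@reindex_fsbigT _ _ _ _ _ u) //; exists v. Qed.

Lemma fsum_ge_term f x : finsupp f -> (forall x, 0 <= f x) -> f x <= fsum f.
Proof.
move=> ff f0; have [Z uZ [fZ _]] := finsupp_uniq ff ff.
case: (eqVneq (f x) 0) => [->|/fZ xZ]; first exact: fsum_ge0.
by rewrite (fsumE uZ fZ) (bigD1_seq x) //= lerDl; apply: sumr_ge0.
Qed.

Lemma finsupp_sum (I : Type) (l : seq I) (F : I -> T -> rat) :
  (forall i, finsupp (F i)) -> finsupp (fun x => \sum_(i <- l) F i x).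
Proof.
move=> FF; elim: l => [|i l IH].
  by exists [::] => x; rewrite big_nil eqxx.
by apply: (finsupp_dom2 (FF i) IH) => x fx gx; rewrite big_cons fx gx addr0.
Qed.

Lemma fsum_sum (I : Type) (l : seq I) (F : I -> T -> rat) :
  (forall i, finsupp (F i)) ->
  fsum (fun x => \sum_(i <- l) F i x) = \sum_(i <- l) fsum (F i).
Proof.
move=> FF; elim: l => [|i l IH].
  rewrite big_nil (@fsumE [::]) ?big_nil // => x.
  by rewrite big_nil eqxx.
rewrite big_cons -IH -fsumD //; last exact: finsupp_sum.
by congr fsum; apply: funext => x; rewrite big_cons.
Qed.

End FiniteSums.

Section CauchySchwarz.
Import Order.TTheory GRing.Theory Num.Theory.
Local Open Scope ring_scope.
Variables (T : eqType) (F : T -> rat).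

Lemma sum_sqr_sub (l : seq T) (c : rat) :
  \sum_(s <- l) (c - F s) ^+ 2 =
  (size l)%:R * c ^+ 2 - 2 * c * \sum_(s <- l) F s + \sum_(s <- l) F s ^+ 2.
Proof.
elim: l => [|s l IH]; first by rewrite !big_nil mul0r mulr0; ring.
rewrite !big_cons IH /= -natr1; ring.
Qed.

Lemma sqr_sum_le (l : seq T) :
  (\sum_(s <- l) F s) ^+ 2 <= (size l)%:R * \sum_(s <- l) F s ^+ 2.
Proof.
elim: l => [|s l IH]; first by rewrite !big_nil mul0r expr0n.
have : 0 <= \sum_(t <- l) (F s - F t) ^+ 2 by apply: sumr_ge0 => t _; exact: sqr_ge0.
rewrite sum_sqr_sub !big_cons /= -natr1; nra.
Qed.

(** The Cauchy-Schwarz inequality with a remainder: a part of the sum of the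
    squares of the differences in Lagrange's identity. *)
Lemma sqr_sum_gap (l : seq T) (s t : T) : t \in l ->
  (\sum_(r <- s :: l) F r) ^+ 2 + (F s - F t) ^+ 2 <=
  (size (s :: l))%:R * \sum_(r <- s :: l) F r ^+ 2.
Proof.
move=> tl.
have : (F s - F t) ^+ 2 <= \sum_(r <- l) (F s - F r) ^+ 2.
  rewrite (big_rem t) //= lerDl; apply: sumr_ge0 => r _; exact: sqr_ge0.
have := sqr_sum_le l.
rewrite sum_sqr_sub !big_cons /= -natr1; nra.
Qed.

End CauchySchwarz.

Section Gap.
Import Order.TTheory GRing.Theory Num.Theory.
Local Open Scope ring_scope.
Variable n : nat.
Variables (S0 : seq (homeo (K n))) (eps : rat).
Hypothesis eps0 : 0 < eps.
Hypothesis NQI : forall mu, finadd_prob mu -> ~ quasi_inv S0 eps mu.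
Implicit Types (f : K n -> rat) (s g : homeo (K n)).

Let T : choiceType := K n.
Let S := 1%g :: S0.
(** The square of the l2 norm. *)
Let N2 f := @fsum T (fun y => f y ^+ 2).

(** The sum of the translates of f by the elements of S: the unnormalized
    Markov operator of the random walk with steps in S. *)
Definition avg f (y : K n) : rat := \sum_(s <- S) f ((s^-1)%g y).

Let finsupp_sqr f : @finsupp T f -> @finsupp T (fun y => f y ^+ 2).
Proof. by move=> ff; apply: (finsupp_dom ff) => x ->; rewrite expr0n. Qed.

Let finsupp_comp f s : @finsupp T f -> @finsupp T (fun y => f (s y)).
Proof. exact: (finsupp_bij (homeo_VK s)). Qed.

Let fsum_comp f s : @fsum T (fun y => f (s y)) = @fsum T f.
Proof. exact: (@fsum_bij T f s _ (homeo_VK s) (homeo_KV s)). Qed.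

Let N2_ge0 f : @finsupp T f -> 0 <= N2 f.
Proof. by move=> ff; apply: fsum_ge0 => [|x]; [exact: finsupp_sqr|exact: sqr_ge0]. Qed.

Lemma finsupp_avg f : @finsupp T f -> @finsupp T (avg f).
Proof. by move=> ff; apply: finsupp_sum => s; exact: finsupp_comp. Qed.

(** Its sum over y is the squared l2 distance of f to its translate by s. *)
Let diff f s (y : K n) := (f y - f (s y)) ^+ 2.

Let finsupp_diff f s : @finsupp T f -> @finsupp T (diff f s).
Proof.
move=> ff; apply: (finsupp_dom2 ff (finsupp_comp s ff)) => x; rewrite /diff => -> ->.
by rewrite subrr expr0n.
Qed.

Let sum_N2 f : @finsupp T f ->
  @fsum T (fun y => (size S)%:R * \sum_(s <- S) f ((s^-1)%g y) ^+ 2) =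
  (size S)%:R ^+ 2 * N2 f.
Proof.
move=> ff; have fs s : @finsupp T (fun y => f ((s^-1)%g y) ^+ 2).
  by apply: finsupp_sqr; exact: finsupp_comp.
rewrite fsumZ; last exact: finsupp_sum.
rewrite fsum_sum // (eq_bigr (fun=> N2 f)); last first.
  by move=> s _; rewrite (fsum_comp (fun y => f y ^+ 2) (s^-1)%g).
by rewrite big_const_seq count_predT iter_addr addr0 -[N2 f *+ _]mulr_natl mulrA expr2.
Qed.

Let finsupp_sum_sqr f : @finsupp T f ->
  @finsupp T (fun y => (size S)%:R * \sum_(s <- S) f ((s^-1)%g y) ^+ 2).
Proof.
move=> ff; have : @finsupp T (fun y => \sum_(s <- S) f ((s^-1)%g y) ^+ 2).
  by apply: finsupp_sum => s; apply: finsupp_sqr; exact: finsupp_comp.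
by move=> /finsupp_dom; apply => x ->; rewrite mulr0.
Qed.

Let N2_avg_le f : @finsupp T f -> N2 (avg f) <= (size S)%:R ^+ 2 * N2 f.
Proof.
move=> ff; rewrite -sum_N2 //; apply: fsum_le.
- exact/finsupp_sqr/finsupp_avg.
- exact: finsupp_sum_sqr.
- move=> y; exact: (sqr_sum_le (fun s => f ((s^-1)%g y))).
Qed.

Let N2_avg_gap f s : @finsupp T f -> s \in S0 ->
  N2 (avg f) + @fsum T (diff f s) <= (size S)%:R ^+ 2 * N2 f.
Proof.
move=> ff sS.
have -> : @fsum T (diff f s) = @fsum T (diff f (s^-1)%g).
  rewrite -(fsum_comp (diff f s) (s^-1)%g); congr fsum; apply: funext => y.
  by rewrite /diff homeo_KV -sqrrN opprB.
rewrite -fsumD; [|exact/finsupp_sqr/finsupp_avg|exact: finsupp_diff].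
rewrite -sum_N2 //; apply: fsum_le.
- apply: (finsupp_dom2 (finsupp_avg ff) (finsupp_diff (s^-1)%g ff)) => y -> ->.
  by rewrite expr0n addr0.
- exact: finsupp_sum_sqr.
- move=> y; rewrite /diff /avg.
  by have := @sqr_sum_gap _ (fun s => f ((s^-1)%g y)) S0 1%g s sS; rewrite invg1.
Qed.

(** If f were close in l2 norm to its translates by the elements of S0, the
    probability with density f^2 (up to normalization) would be almost
    invariant. *)
Let exists_diff f : @finsupp T f -> 0 < N2 f ->
  exists2 s, s \in S0 & eps ^+ 2 / 4 * N2 f <= @fsum T (diff f s).
Proof.
move=> ff N0; apply: contrapT => H.
pose nu (A : set (K n)) (y : K n) := f y ^+ 2 * (y \in A)%:R.
have finsnu A : @finsupp T (nu A).
  by apply: (finsupp_dom ff) => y; rewrite /nu => ->; rewrite expr0n mul0r.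
apply: (@NQI (fun A => @fsum T (nu A) / N2 f)); first split.
- rewrite -[RHS](@divff _ (N2 f)) ?gt_eqF //; congr (fsum _ / _).
  by apply: funext => y; rewrite /nu in_setT mulr1.
- move=> A; apply: divr_ge0; last exact: ltW.
  by apply: fsum_ge0 => // y; apply: mulr_ge0; rewrite ?sqr_ge0.
- move=> A B AB; rewrite -mulrDl -fsumD //; congr (fsum _ / _); apply: funext => y.
  rewrite /nu in_setU -mulrDr; congr (_ * _).
  case: (boolP (y \in A)) => yA; case: (boolP (y \in B)) => yB //=.
  exfalso.
  have : (A `&` B) y by split; exact: set_mem.
  by rewrite AB.
- move=> s A sS; rewrite -(@ler_pM2r _ (N2 f)) // mulrDl !divfK ?gt_eqF //.
  have small : @fsum T (diff f s) <= eps ^+ 2 / 4 * N2 f.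
    by rewrite leNgt; apply/negP => /ltW ?; apply: H; exists s.
  have -> : @fsum T (nu (s @` A)) = @fsum T (fun y => f (s y) ^+ 2 * (y \in A)%:R).
    rewrite -(fsum_comp (nu _) s); congr fsum; apply: funext => y; rewrite /nu.
    congr (_ * (nat_of_bool _)%:R); apply/idP/idP => yA; apply: mem_set.
      by have [z Az /homeo_inj <-] := set_mem yA.
    by exists y => //; exact: set_mem.
  have fg : @finsupp T (fun y => f (s y) ^+ 2 * (y \in A)%:R).
    by apply: (finsupp_dom (finsupp_comp s ff)) => y ->; rewrite expr0n mul0r.
  have fh : @finsupp T (fun y => eps / 2 * f y ^+ 2).
    by apply: (finsupp_dom ff) => y ->; rewrite expr0n mulr0.
  have fk : @finsupp T (fun y => 2 / eps * diff f s y).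
    by apply: (finsupp_dom (finsupp_diff s ff)) => y ->; rewrite mulr0.
  have fhk : @finsupp T (fun y => eps / 2 * f y ^+ 2 + 2 / eps * diff f s y).
    by apply: (finsupp_dom2 fh fk) => y -> ->; rewrite addr0.
  have : @fsum T (nu A) <= @fsum T (fun y => f (s y) ^+ 2 * (y \in A)%:R +
      (eps / 2 * f y ^+ 2 + 2 / eps * diff f s y)).
    apply: fsum_le => //.
      by apply: (finsupp_dom2 fg fhk) => y -> ->; rewrite addr0.
    move=> y; rewrite /nu /diff; set a := f y; set b := f (s y).
    have pos : 0 <= eps / 2 * a ^+ 2 + 2 / eps * (a - b) ^+ 2.
      by apply: addr_ge0; apply: mulr_ge0; rewrite ?sqr_ge0 ?divr_ge0 // ltW.
    case: (y \in A); rewrite ?mulr1 ?mulr0 ?add0r //.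
    have : 0 <= (eps / 2 * a - (a - b)) ^+ 2 by exact: sqr_ge0.
    have : 2 / eps * (eps / 2) = 1 by field; rewrite gt_eqF.
    set c := 2 / eps; set d := eps / 2 => cd sq.
    have c0 : 0 < c by rewrite divr_gt0.
    have : 0 <= c * (d * a - (a - b)) ^+ 2 by rewrite mulr_ge0 // ltW.
    have -> : c * (d * a - (a - b)) ^+ 2 =
      (c * d) * d * a ^+ 2 - 2 * (c * d) * a * (a - b) + c * (a - b) ^+ 2 by ring.
    by rewrite cd; have := sqr_ge0 (a - b); nra.
  rewrite !fsumD // (fsumZ _ (finsupp_sqr ff)) (fsumZ _ (finsupp_diff s ff)).
  move=> /le_trans; apply; rewrite lerD2l -/(N2 f).
  have : 2 / eps * @fsum T (diff f s) <= 2 / eps * (eps ^+ 2 / 4 * N2 f).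
    by rewrite ler_wpM2l // divr_ge0 // ltW.
  have -> : 2 / eps * (eps ^+ 2 / 4 * N2 f) = eps / 2 * N2 f.
    by field; rewrite gt_eqF.
  lra.
Qed.

(** The norm of the Markov operator on l2 is less than the number of steps. *)
Lemma spectral_gap : exists2 kap : rat, 0 <= kap < (size S)%:R ^+ 2 &
  forall f, @finsupp T f -> N2 (avg f) <= kap * N2 f.
Proof.
pose del := Num.min 1 (eps ^+ 2 / 4).
have del0 : 0 < del by rewrite lt_min ltr01 divr_gt0 // exprn_gt0.
have del1 : del <= 1 by rewrite ge_min lexx.
have dele : del <= eps ^+ 2 / 4 by rewrite ge_min lexx orbT.
have S1 : 1 <= (size S)%:R ^+ 2 :> rat by rewrite exprn_ege1 // ler1n.
exists ((size S)%:R ^+ 2 - del) => [|f ff]; first by apply/andP; split; lra.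
have := N2_ge0 ff; rewrite le_eqVlt => /predU1P [N0|N0].
  by have := N2_avg_le ff; rewrite -N0 !mulr0.
have [s sS sd] := exists_diff ff N0.
have := N2_avg_gap ff sS.
have : del * N2 f <= eps ^+ 2 / 4 * N2 f by rewrite ler_wpM2r // ltW.
by rewrite mulrBl; lra.
Qed.

(** The products of k elements of S, listed with multiplicity. *)
Fixpoint words (k : nat) : seq (homeo (K n)) :=
  if k is k'.+1 then [seq (s * g)%g | s <- S, g <- words k'] else [:: 1%g].

Lemma size_words k : size (words k) = (size S ^ k)%N.
Proof. by elim: k => // k IH; rewrite /words size_allpairs -/(words k) IH expnS. Qed.

Lemma words_word k g : g \in words k -> word S k g.
Proof.
elim: k g => [|k IH] g; first by rewrite inE => /eqP ->; exact: word0.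
by move=> /allpairsP [[s h] /= [sS hk ->]]; apply: wordS => //; exact: IH.
Qed.

(** The number of words of length k that send x to y. *)
Definition visits (x : K n) k (y : K n) : rat := \sum_(g <- words k) (g x == y)%:R.

Lemma visitsS x k : visits x k.+1 = avg (visits x k).
Proof.
apply: funext => y; rewrite /visits /avg /words big_allpairs_dep -/(words k).
apply: eq_bigr => s _; apply: eq_bigr => g _; congr (nat_of_bool _)%:R.
rewrite homeo_mulE; apply/eqP/eqP => [<-|->]; first by rewrite homeo_VK.
by rewrite homeo_KV.
Qed.

Lemma finsupp_visits x k : @finsupp T (visits x k).
Proof.
elim: k => [|k IH]; last by rewrite visitsS; exact: finsupp_avg.
by exists [:: x] => y; rewrite /visits big_seq1 homeo_1E;
  case: (eqVneq x y) => [->|_]; rewrite ?mem_head ?eqxx.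
Qed.

(** The power j of the operator makes the decay as fast as 16^(-t). *)
Lemma visits_decay : exists2 j, (0 < j)%N & forall t x y,
  16%:R ^+ t * visits x (j * t) y <= (size (words (j * t)))%:R.
Proof.
have [kap /andP [kap0 kapS] gap] := spectral_gap.
set s2 := (size S)%:R ^+ 2 in kapS.
have bound x k : N2 (visits x k) <= kap ^+ k.
  elim: k => [|k IH].
    rewrite /N2 (@fsumE _ [:: x]) //.
      by rewrite big_seq1 /visits big_seq1 homeo_1E eqxx expr1n.
    by move=> y; rewrite /visits big_seq1 homeo_1E;
      case: (eqVneq x y) => [->|_]; rewrite ?mem_head ?expr0n ?eqxx.
  rewrite visitsS; apply: le_trans (gap _ (finsupp_visits x k)) _.
  by rewrite exprS ler_wpM2l.
have s0 : 0 < s2 by apply: le_lt_trans kapS.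
pose eta := (s2 - kap) / s2.
have eta0 : 0 < eta by rewrite divr_gt0 // subr_gt0.
have kapE : kap * (1 + eta) <= s2.
  have e : eta * s2 = s2 - kap by rewrite /eta divfK // gt_eqF.
  have e2 : eta * (s2 - kap) >= 0 by rewrite mulr_ge0 ?subr_ge0 // ltW.
  by nra.
have bern (j : nat) : 1 + j%:R * eta <= (1 + eta) ^+ j.
  elim: j => [|j IH]; first by rewrite mul0r addr0.
  rewrite exprS -natr1.
  have : 0 <= j%:R * eta * eta.
    by apply: mulr_ge0; [apply: mulr_ge0|]; rewrite ?ler0n ?(ltW eta0).
  have : (1 + eta) * (1 + j%:R * eta) <= (1 + eta) * (1 + eta) ^+ j.
    by rewrite ler_wpM2l //; lra.
  by rewrite mulrDr mulrDl; lra.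
have [q q0 qE] : exists2 q : rat, 0 < q & 16%:R ^+ 2 = q.
  by exists (16%:R ^+ 2); [apply: exprn_gt0; exact: ltr0Sn|].
pose j := (Num.bound (q / eta)).+1.
exists j => // t x y.
have jeta : q <= (1 + eta) ^+ j.
  apply: le_trans (bern j); have : q / eta < (Num.bound (q / eta))%:R.
    by apply: archi_boundP; apply: divr_ge0; exact: ltW.
  rewrite ltr_pdivrMr // /j -natr1 mulrDl mul1r; lra.
have kj : q * kap ^+ j <= s2 ^+ j.
  apply: le_trans (_ : (1 + eta) ^+ j * kap ^+ j <= _).
    by rewrite ler_wpM2r // exprn_ge0.
  rewrite -exprMn mulrC lerXn2r // ?nnegrE; last exact: ltW.
  by rewrite mulr_ge0 // addr_ge0 // ltW.
have v0 : 0 <= visits x (j * t) y by apply: sumr_ge0.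
rewrite -(@ler_sqr _ (16%:R ^+ t * _)) ?nnegrE //; last by rewrite mulr_ge0 // exprn_ge0.
rewrite exprMn size_words natrX -!exprM ![(_ * 2)%N]mulnC exprM.
rewrite qE [leRHS]exprM -/s2.
have vb : visits x (j * t) y ^+ 2 <= kap ^+ (j * t).
  apply: le_trans (bound x (j * t)%N).
  by apply: (@fsum_ge_term T (fun y => visits x (j * t) y ^+ 2)) => [|z];
    [exact/finsupp_sqr/finsupp_visits|exact: sqr_ge0].
apply: le_trans (_ : q ^+ t * kap ^+ (j * t) <= _).
  by apply: ler_wpM2l vb; apply: exprn_ge0; exact: ltW.
rewrite !exprM -exprMn; apply: lerXn2r kj; rewrite nnegrE.
  by apply: mulr_ge0; [exact: ltW|exact: exprn_ge0].
by apply: exprn_ge0; exact: ltW.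
Qed.

Lemma escape_S : exists2 j, (0 < j)%N & forall t (PP : seq (K n * K n)),
  (size PP < 16 ^ t)%N ->
  exists2 g, word S (j * t) g & forall xy, xy \in PP -> g xy.1 <> xy.2.
Proof.
have [j j0 H] := visits_decay; exists j => // t PP PPt.
set W := words (j * t).
suff : has (fun g : homeo (K n) => all (fun xy => g xy.1 != xy.2) PP) W.
  move=> /hasP [g /words_word gW /allP gP]; exists g => // xy /gP /eqP; exact.
apply/negPn/negP => /hasPn noW.
have : (size W)%:R <= \sum_(xy <- PP) visits xy.1 (j * t) xy.2.
  rewrite /visits exchange_big /= -/W.
  have -> : (size W)%:R = \sum_(g <- W) 1 :> rat.
    by rewrite big_const_seq count_predT iter_addr addr0.
  rewrite big_seq [leRHS]big_seq; apply: ler_sum => g gW.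
  have /allPn [xy xyP /negPn gxy] := noW g gW.
  rewrite (big_rem xy) //= gxy lerDl; exact: sumr_ge0.
have W0 : 0 < (size W)%:R :> rat by rewrite size_words ltr0n expn_gt0.
move=> le1.
have : 16%:R ^+ t * (size W)%:R <= (size PP)%:R * (size W)%:R :> rat.
  apply: le_trans (ler_wpM2l _ le1) _; first by rewrite exprn_ge0.
  rewrite mulr_sumr.
  have -> : (size PP)%:R * (size W)%:R = \sum_(xy <- PP) (size W)%:R :> rat.
    by rewrite big_const_seq count_predT iter_addr addr0 mulr_natl.
  by apply: ler_sum => xy _; exact: H.
by rewrite ler_pM2r // -natrX ler_nat leqNgt PPt.
Qed.

End Gap.

(** * Random words avoid prescribed transitions *)

Section Escape.
Variables (n : nat) (hn : (2 <= n)%N) (Gamma : set (homeo (K n))).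
Hypothesis Gsub : subgroup Gamma.
Hypothesis GV : Gamma `<=` thompsonV (n := n).
Hypothesis Gfg : finitely_generated Gamma.
Hypothesis orbits_infinite : forall x, ~ finite_set (orbit_of Gamma x).

(** Fewer than 16^t transitions from a point to a point are avoided
    simultaneously by some word of length j * t. *)
Lemma escape : exists S j, [/\ forall s, s \in S -> Gamma s, (0 < j)%N &
  forall t (PP : seq (K n * K n)), (size PP < 16 ^ t)%N ->
  exists2 g, word S (j * t) g & forall xy, xy \in PP -> g xy.1 <> xy.2].
Proof.
have [S0 [eps [SG eps0 NQI]]] := no_quasi_invariant hn Gsub GV Gfg orbits_infinite.
have [j j0 H] := escape_S eps0 NQI; exists (1%g :: S0), j; split => // s.
by rewrite inE => /predU1P [->|/SG //]; case: Gsub.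
Qed.

End Escape.

(** * Intervals on which a word is not affine *)

Section Nonaffine.
Variables (n : nat) (hn : (2 <= n)%N).
Implicit Types (a b c v : vertex n) (x y u : K n) (g h s : homeo (K n)).

(** At most m intervals are such that g is not affine on them. *)
Definition few_nonaffine (m : nat) g : Prop := exists l : seq (vertex n),
  (size l <= m)%N /\ forall v, (forall c, ~ affine g v c) -> v \in l.

Lemma few_nonaffineW m m' g : (m <= m')%N -> few_nonaffine m g -> few_nonaffine m' g.
Proof. by move=> mm [l [lm H]]; exists l; split => //; apply: leq_trans mm. Qed.

Lemma few_nonaffine1 : few_nonaffine 0 1%g.
Proof. by exists [::]; split => // v /(_ v) []; exact: affine1. Qed.

(** An interval on which s * g is not affine is either one on which g is not
    affine, or is sent by g onto one on which s is not affine; g is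
    injective on the latter kind. So the number of these intervals grows at
    most linearly with the length of a word. *)
Lemma few_nonaffineM m m' s g : few_nonaffine m s -> few_nonaffine m' g ->
  few_nonaffine (m + m') (s * g)%g.
Proof.
move=> [ls [lsm sH]] [lg [lgm gH]].
have [pb pbP] : exists pb : vertex n -> vertex n, forall v c, affine g v c -> pb c = v.
  suff /choice [pb H] : forall c, exists v', forall v, affine g v c -> v' = v.
    by exists pb => v c; exact: H.
  move=> c; case: (pselect (exists v, affine g v c)) => [[v vc]|H].
    by exists v => v'; exact: (affine_src_uniq hn).
  by exists c => v vc; case: H; exists v.
exists (map pb ls ++ lg); rewrite size_cat size_map leq_add //; split => // v vH.
rewrite mem_cat orbC; case: (boolP (v \in lg)) => //= vlg.
have [c vc] : exists c, affine g v c.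
  apply: contrapT => H; case/negP: vlg; apply: gH => c vc.
  by apply: H; exists c.
rewrite -(pbP _ _ vc); apply: map_f; apply: sH => c' cc'.
by apply: (vH c'); exact: affine_comp cc'.
Qed.

Lemma few_nonaffine_locaff g : locaff g -> exists m, few_nonaffine m g.
Proof.
move=> [D gD]; exists (size (verts_upto n D)), (verts_upto n D); split => // v vH.
rewrite mem_verts_upto; case: leqP => // /ltnW /gD [c vc].
by case: (vH c).
Qed.

Lemma word_few_nonaffine (S : seq (homeo (K n))) p k g :
  (forall s, s \in S -> few_nonaffine p s /\ few_nonaffine p (s^-1)%g) ->
  word S k g -> few_nonaffine (p * k) g /\ few_nonaffine (p * k) (g^-1)%g.
Proof.
move=> Sp; elim/word_ind: g /.
  by rewrite muln0 invg1; split; exact: few_nonaffine1.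
move=> {}k s g /Sp [s1 s2] _ [g1 g2]; rewrite mulnS; split.
  exact: few_nonaffineM.
by rewrite invgM addnC; exact: few_nonaffineM.
Qed.

Lemma size_verts_upto d : (size (verts_upto n d) <= d.+1 * n ^ d)%N.
Proof.
rewrite /verts_upto -{2}(size_iota 0 d.+1).
have : all (fun k => k <= d)%N (iota 0 d.+1).
  by apply/allP => k; rewrite mem_iota.
elim: (iota _ _) => //= k l IH /andP [kd /IH {}IH].
by rewrite size_cat size_verts mulSn leq_add // leq_pexp2l // ltnW.
Qed.

(** Let T be the union of the intervals of depth d on which g or its inverse
    is not affine. If x and g x are outside T, then g is affine near x, and
    one of the intervals of depth d around x and g x is matched with an
    interval of depth at most d. Without matched pairs of depth at most d,
    g thus sends the complement of T into T. *)
Lemma complement_into (d m : nat) g : few_nonaffine m g -> few_nonaffine m (g^-1)%g ->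
  (forall v c, (size v <= d)%N -> (size c <= d)%N -> ~ affine g v c) ->
  exists l : seq (vertex n), (size l <= m + m)%N /\
    forall x, pfx d x \notin l -> pfx d (g x) \in l.
Proof.
move=> [l [lm lH]] [l' [lm' lH']] noaff; exists (l ++ l').
split; first by rewrite size_cat leq_add.
move=> x; rewrite !mem_cat negb_or => /andP [xl _].
case: (boolP (pfx d (g x) \in l')) => [_|gxl']; first by rewrite orbT.
have [c vc] : exists c, affine g (pfx d x) c.
  by apply: contrapT => H; case/negP: xl; apply: lH => c vc; apply: H; exists c.
have [c' vc'] : exists c', affine (g^-1)%g (pfx d (g x)) c'.
  by apply: contrapT => H; case/negP: gxl'; apply: lH' => c' vc'; apply: H; exists c'.
have cv := affine_inv vc'; rewrite invgK in cv.
case: (leqP (size c) d) => cd; first by case: (noaff _ _ _ cd vc); rewrite size_pfx.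
have sc' : starts c' x.
  by rewrite -(homeo_VK g x); apply: affine_starts vc' _; exact: starts_pfx.
have := affine_depth hn vc cv (starts_pfx d x) sc'; rewrite !size_pfx => E.
by case: (noaff c' (pfx d (g x))); rewrite ?size_pfx //; lia.
Qed.

Lemma starts_take v y d : starts v y -> (size v <= d)%N -> v = take (size v) (pfx d y).
Proof.
move=> vy vd; have [|e E] := starts_ext vy (starts_pfx d y); first by rewrite size_pfx.
by rewrite E take_size_cat.
Qed.

(** Let V and W be the intervals of depth d around x and h x. Both h V and W
    contain h x, so one of them contains the other. If h V is the larger one, it
    is the interval of a prefix of length e of h x, and the image of the
    point of V with remaining digits 0 is known. Otherwise the same holds for
    the inverse of h and for W. *)
Lemma meet_equation (d : nat) h x :
  (exists c, affine h (pfx d x) c) -> (exists c, affine (h^-1)%g (pfx d (h x)) c) ->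
  exists2 e, (e <= d)%N &
    h (prepend (pfx d x) (zeros hn)) = prepend (take e (pfx d (h x))) (zeros hn) \/
    h (prepend (take e (pfx d x)) (zeros hn)) = prepend (pfx d (h x)) (zeros hn).
Proof.
move=> [c vc] [c' vc']; have cv := affine_inv vc'; rewrite invgK in cv.
have hc := affine_starts vc (starts_pfx d x).
have sc' : starts c' x.
  by rewrite -(homeo_VK h x); apply: affine_starts vc' _; exact: starts_pfx.
have := affine_depth hn vc cv (starts_pfx d x) sc'; rewrite !size_pfx => E.
case: (leqP (size c) d) => cd.
  by exists (size c) => //; left; rewrite vc -starts_take.
have c'd : (size c' <= d)%N by lia.
by exists (size c') => //; right; rewrite -starts_take // cv.
Qed.

(** Here l describes the union T of the intervals of its vertices of depth d.
    Some short word moves T off finitely many given translates of T, because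
    this amounts to avoiding few transitions between points. *)
Lemma disjoint_translate (S S2 : seq (homeo (K n))) (D k d t : nat)
  (l : seq (vertex n)) (gs : seq (homeo (K n))) :
  {subset S <= S2} -> (forall s, s \in S2 -> (s^-1)%g \in S2) ->
  (forall s, s \in S2 -> affine_below D s) -> d = (2 * (D * k))%N ->
  (forall PP : seq (K n * K n), (size PP < 16 ^ t)%N ->
     exists2 g, word S k g & forall xy, xy \in PP -> g xy.1 <> xy.2) ->
  (forall g, g \in gs -> word S k g) ->
  (size gs * (size l * size l) * d.+1 * 2 < 16 ^ t)%N ->
  exists2 g, word S k g & forall h, h \in gs -> forall x y,
    pfx d x \in l -> pfx d y \in l -> g x <> h y.
Proof.
move=> SS2 S2V S2D dE esc gsw small.
have mono g : word S k g -> word S2 k g.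
  by move=> [w [wk wS ->]]; exists w; split => // s /wS /SS2.
pose I := (homeo (K n) * ((vertex n * vertex n) * nat))%type.
pose ind : seq I := [seq (h, z) | h <- gs, z <-
  [seq (z, e) | z <- [seq (v, q) | v <- l, q <- l], e <- iota 0 d.+1]].
pose P1 (i : I) : K n * K n :=
  (prepend i.2.1.1 (zeros hn), i.1 (prepend (take i.2.2 i.2.1.2) (zeros hn))).
pose P2 (i : I) : K n * K n :=
  (prepend (take i.2.2 i.2.1.1) (zeros hn), i.1 (prepend i.2.1.2 (zeros hn))).
have [|g gw gP] := esc (map P1 ind ++ map P2 ind).
  rewrite size_cat !size_map !size_allpairs size_iota; apply: leq_ltn_trans small.
  by lia.
exists g => // h hgs x y xl yl gx.
pose f := (h^-1 * g)%g.
have fx : f x = y by rewrite /f homeo_mulE gx homeo_VK.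
have aff g1 g2 z : word S2 k g1 -> word S2 k g2 ->
    exists c, affine (g1^-1 * g2)%g (pfx d z) c.
  move=> w1 w2; have [|b zb db] := word_affine (a := pfx d z) S2D w2.
    by rewrite size_pfx; lia.
  have [|c bc _] := word_affine (a := b) S2D (word_inv S2V w1).
    by move: db; rewrite size_pfx; lia.
  by exists c; exact: affine_comp bc.
have gw2 := mono _ gw; have hw2 := mono _ (gsw _ hgs).
have fV : (f^-1 = g^-1 * h)%g by rewrite /f invgM invgK.
have [|e ed] := @meet_equation d f x (aff _ _ _ hw2 gw2).
  by rewrite fV; exact: aff.
have iind : (h, ((pfx d x, pfx d y), e)) \in ind.
  apply: allpairs_f => //; apply: allpairs_f; last by rewrite mem_iota.
  exact: allpairs_f.
rewrite fx => -[] E.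
  have := gP (P1 (h, ((pfx d x, pfx d y), e))); rewrite mem_cat map_f // => /(_ isT).
  by apply; rewrite /= -E /f homeo_mulE homeo_KV.
have := gP (P2 (h, ((pfx d x, pfx d y), e))).
rewrite mem_cat (map_f P2) // orbT => /(_ isT).
by apply; rewrite /= -E /f homeo_mulE homeo_KV.
Qed.

End Nonaffine.

(** * Ping-pong *)

Section PingPong.
Variables (n : nat) (a b : homeo (K n)) (X : letter -> set (K n)) (z : K n).
Hypothesis Xz : forall l, ~ X l z.
Hypothesis Xdisj : forall l m x, X l x -> X m x -> l = m.
Hypothesis Xstep : forall l x, ~ X (l.1, ~~ l.2) x -> X l (eval_letter a b l x).

(** The set X l receives the complement of X l' under the letter l, where l' is
    the inverse letter; so a reduced word moves z into the set of its first
    letter. *)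
Lemma ping_pong w : reduced w -> w != [::] -> eval_word a b w <> 1%g.
Proof.
move=> rw w0 w1.
suff : X (head (false, false) w) (eval_word a b w z).
  by rewrite w1 homeo_1E; exact: Xz.
elim: w rw w0 {w1} => // l w IH rw _ /=.
rewrite /eval_word big_cons homeo_mulE -/(eval_word a b w); apply: Xstep.
case: w IH rw => [|m w] IH rw; first by rewrite /eval_word big_nil homeo_1E.
move: rw; rewrite /reduced /= => /andP [ml mw] Xl.
by have /= E := Xdisj (IH mw isT) Xl; rewrite E eqxx in ml.
Qed.

End PingPong.

(** * Choice of the lengths, and the dichotomy *)

Section Counting.

Lemma ltn_exp16 C t : (C < t)%N -> (C * (t * t * t) < 16 ^ t)%N.
Proof.
move=> Ct; have -> : 16 = 2 * (2 * 2 * 2) by [].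
rewrite !expnMn.
have e : (t < 2 ^ t)%N by exact: ltn_expl.
have q : (t * t * t <= 2 ^ t * 2 ^ t * 2 ^ t)%N by rewrite !leq_mul // ltnW.
apply: (@leq_ltn_trans (C * (2 ^ t * 2 ^ t * 2 ^ t))); first by rewrite leq_mul2l q orbT.
rewrite ltn_pmul2r ?(ltn_trans Ct) //.
by rewrite !muln_gt0 !expn_gt0.
Qed.

Lemma sqr_size_verts_upto n d : ((d.+1 * n ^ d) * (d.+1 * n ^ d) < 16 ^ (d * n.+1).+1)%N.
Proof.
have le : (d.+1 * n ^ d <= 2 ^ (d * n.+1))%N.
  rewrite mulnS expnD leq_mul //; first exact: ltn_expl.
  rewrite mulnC expnM; case: d => // d; rewrite leq_exp2r //.
  by apply: ltnW; exact: ltn_expl.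
apply: leq_ltn_trans (leq_mul le le) _.
rewrite -expnD; apply: (@leq_trans (2 ^ (d * n.+1 + d * n.+1).+1)).
  by rewrite ltn_exp2l.
rewrite (_ : 16 = 2 ^ 4) // -expnM leq_exp2l //; lia.
Qed.

End Counting.

Theorem theorem1p5 (n : nat) (hn : (2 <= n)%N) (Gamma : set (homeo (K n)))
    (Gamma_subgroup : subgroup Gamma)
    (Gamma_V : Gamma `<=` thompsonV (n := n))
    (Gamma_fg : finitely_generated Gamma) :
  (exists x : K n, finite_set (orbit_of Gamma x)) \/
  contains_free_subgroup2 Gamma.
Proof.
have [fo|no_fo] := pselect (exists x : K n, finite_set (orbit_of Gamma x)).
  by left.
have orbits_infinite x : ~ finite_set (orbit_of Gamma x).
  by move=> fx; apply: no_fo; exists x.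
right; have [G1 GM GI] := Gamma_subgroup.
have [S [j [SG j0 esc]]] := escape hn Gamma_subgroup Gamma_V Gamma_fg orbits_infinite.
pose S2 := S ++ map (fun s => s^-1)%g S.
have SS2 : {subset S <= S2} by move=> s sS; rewrite mem_cat sS.
have S2V s : s \in S2 -> (s^-1)%g \in S2.
  rewrite !mem_cat => /orP [sS|/mapP [r rS ->]]; last by rewrite invgK rS.
  by apply/orP; right; apply/mapP; exists s.
have S2G s : s \in S2 -> Gamma s.
  by rewrite mem_cat => /orP [/SG //|/mapP [r /SG rS ->]]; exact: GI.
have [D S2D] : exists D, forall s, s \in S2 -> affine_below D s.
  apply: common_bound => [s i k|s /S2G]; first exact: affine_belowW.
  exact: (subgroup_locaff hn Gamma_V).
have [p S2p] : exists p, forall s, s \in S2 -> few_nonaffine p s.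
  apply: common_bound => [s i k|s sS]; first exact: few_nonaffineW.
  by apply: few_nonaffine_locaff; exists D; exact: S2D.
have Sp s : s \in S -> few_nonaffine p s /\ few_nonaffine p (s^-1)%g.
  by move=> /SS2 sS; split; apply: S2p => //; exact: S2V.
(* The union T below has at most C1 * t intervals, of depth d < C2 * t. *)
pose C1 := (2 * (p * (j * (2 * (D * j) * n.+1).+1)))%N.
pose C2 := (2 * (D * j)).+1.
have [t tC] : exists t, (8 * (C1 * C1) * C2 < t)%N.
  by exists (8 * (C1 * C1) * C2).+1.
have t0 : (0 < t)%N by apply: leq_ltn_trans tC.
pose d := (2 * (D * (j * t)))%N.
pose t' := (d * n.+1).+1.
(* A word g for which no two vertices of depth at most d are matched. The
   length j * t' is linear in d, whereas the number of such pairs of vertices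
   is exponential in d. *)
have [|g gw gP] := esc t' [seq (prepend v (zeros hn), prepend c (zeros hn)) |
    v <- verts_upto n d, c <- verts_upto n d].
  rewrite size_allpairs; apply: leq_ltn_trans (sqr_size_verts_upto n d).
  by apply: leq_mul; exact: size_verts_upto.
have [few fewV] := word_few_nonaffine hn Sp gw.
have [|l [lm lP]] := complement_into hn few fewV (d := d).
  move=> v c vd cd gvc.
  apply: (gP (prepend v (zeros hn), prepend c (zeros hn))); last exact: gvc.
  by apply: (allpairs_f (fun v c => (prepend v (zeros hn), prepend c (zeros hn))));
    rewrite mem_verts_upto.
have Gg : Gamma g by exact: word_sub Gamma_subgroup SG gw.
have lC : (size l <= C1 * t)%N.
  apply: leq_trans lm _; rewrite /C1 /t' /d.
  have : ((2 * (D * (j * t)) * n.+1).+1 <= (2 * (D * j) * n.+1).+1 * t)%N.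
    have -> : (2 * (D * (j * t)) * n.+1 = 2 * (D * j) * n.+1 * t)%N by lia.
    by rewrite mulSn -[leqLHS]add1n leq_add2r.
  move: (_.+1) ((2 * (D * j) * n.+1).+1) => A B AB.
  have : (p * (j * A) <= p * (j * (B * t)))%N by rewrite !leq_mul2l AB !orbT.
  lia.
have dC : (d.+1 <= C2 * t)%N.
  have -> : d = (2 * (D * j) * t)%N by rewrite /d; lia.
  by rewrite mulSn -[leqLHS]add1n leq_add2r.
have small (r : nat) : (r <= 4)%N -> (r * (size l * size l) * d.+1 * 2 < 16 ^ t)%N.
  move=> r4; apply: leq_ltn_trans (ltn_exp16 tC).
  apply: (@leq_trans (4 * ((C1 * t) * (C1 * t)) * (C2 * t) * 2)).
    by rewrite leq_mul // leq_mul // leq_mul // leq_mul.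
  by apply: eq_leq; ring.
have ext gs : (size gs <= 4)%N -> (forall h, h \in gs -> word S (j * t) h) ->
    exists2 g, word S (j * t) g & forall h, h \in gs -> forall x y,
      pfx d x \in l -> pfx d y \in l -> g x <> h y.
  by move=> gs4 gsw; apply: (disjoint_translate hn SS2 S2V S2D (t := t)) => //;
    [exact: esc|exact: small].
(* Five pairwise disjoint translates of T: four for the letters, and a last
   one that contains the point to be moved. *)
have [|g0 w0 _] := ext [::] isT; first by [].
have [|g1 w1 d1] := ext [:: g0] isT; first by move=> h; rewrite inE => /eqP ->.
have [|g2 w2 d2] := ext [:: g0; g1] isT.
  by move=> h; rewrite !inE => /orP [] /eqP ->.
have [|g3 w3 d3] := ext [:: g0; g1; g2] isT.
  by move=> h; rewrite !inE => /or3P [] /eqP ->.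
have [|g4 w4 d4] := ext [:: g0; g1; g2; g3] isT.
  by move=> h; rewrite !inE => /or4P [] /eqP ->.
have WG h : word S (j * t) h -> Gamma h by exact: word_sub.
pose a := (g0 * g * g1^-1)%g; pose b := (g2 * g * g3^-1)%g.
have Ga : Gamma a.
  by apply: (GM); [apply: (GM); [exact: WG w0|exact: Gg]|apply: GI; exact: WG w1].
have Gb : Gamma b.
  by apply: (GM); [apply: (GM); [exact: WG w2|exact: Gg]|apply: GI; exact: WG w3].
exists (generated [set a; b]); split.
  by move=> h H; apply: H; split => // x [->|->].
exists a, b; split => //.
pose gam (i : letter) :=
  if i.1 then (if i.2 then g3 else g2) else (if i.2 then g1 else g0).
pose X (i : letter) : set (K n) := [set x | pfx d (((gam i)^-1)%g x) \in l].
have [y yl] : exists y, pfx d y \in l.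
  case: (boolP (pfx d (zeros hn) \in l)) => [|/lP] H; first by exists (zeros hn).
  by exists (g (zeros hn)).
have lPV x : pfx d x \notin l -> pfx d ((g^-1)%g x) \in l.
  by move=> xl; apply: contraNT xl => /lP; rewrite homeo_KV.
have step (h k : homeo (K n)) x : pfx d ((k^-1)%g x) \notin l ->
    pfx d ((h^-1)%g ((h * g * k^-1)%g x)) \in l.
  by move=> xl; rewrite !homeo_mulE homeo_VK; exact: lP.
have stepV (h k : homeo (K n)) x : pfx d ((h^-1)%g x) \notin l ->
    pfx d ((k^-1)%g (((h * g * k^-1)^-1)%g x)) \in l.
  by move=> xl; rewrite !invgM invgK !homeo_mulE homeo_VK; exact: lPV.
have gamX i x : X i x -> exists2 z, pfx d z \in l & gam i z = x.
  by move=> Xx; exists (((gam i)^-1)%g x) => //; rewrite homeo_KV.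
apply: (@ping_pong n a b X (g4 y)).
- move=> i /gamX [z zl]; move/esym; apply: d4 => //.
  by rewrite /gam !inE; case: i => -[] []; rewrite eqxx ?orbT.
- move=> i k x /gamX [z zl <-] /gamX [z' zl'].
  case: i k => -[] [] [] -[] [] //; rewrite /gam /= => E; exfalso;
  by [ apply: d3 E; rewrite ?inE ?eqxx ?orbT | apply: d2 E; rewrite ?inE ?eqxx ?orbT
     | apply: d1 E; rewrite ?inE ?eqxx ?orbT
     | move/esym: E => E; apply: d3 E; rewrite ?inE ?eqxx ?orbT
     | move/esym: E => E; apply: d2 E; rewrite ?inE ?eqxx ?orbT
     | move/esym: E => E; apply: d1 E; rewrite ?inE ?eqxx ?orbT ].
- by case=> -[] [] x /negP; [exact: stepV|exact: step|exact: stepV|exact: step].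
Qed.
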